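(* Work in $\mathbf{ZF}$. For every commutative field $\mathbb K$, the statements $\mathbf{D}_{\mathbb K}$ and $\mathbf{LE}_{\mathbb K}$ are equivalent, where $\mathbf{D}_{\mathbb K}$: for every non-null $\mathbb K$-vector space $E$ there exists a non-null $\mathbb K$-linear form $f:E\to\mathbb K$; $\mathbf{LE}_{\mathbb K}$: for every vector subspace $F$ of a $\mathbb K$-vector space $E$, there exists a $\mathbb K$-linear mapping $T:F^*\to E^*$ such that for every $f\in F^*$, the linear form $T(f):E\to\mathbb K$ extends $f$.
   Context: $E^*$ denotes the algebraic dual of a $\mathbb K$-vector space $E$, i.e. the vector space of all $\mathbb K$-linear maps $E\to\mathbb K$. The ambient set theory is $\mathbf{ZF}$ without the Axiom of Choice. *)

(* Defs.v *)
(* The metatheory may prove choice principles, so quantifying over Rocq types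
   would not express a theorem of ZF.  "Work in ZF" is rendered as "in every
   model of first-order ZF": a [set_structure] is a bare type with a binary
   relation, the two axiom schemata range over first-order formulas with
   parameters only, and every algebraic notion below is a first-order property
   whose quantifiers range over the elements ("sets") of the structure. *)

Set Implicit Arguments.
Unset Strict Implicit.
Unset Printing Implicit Defensive.

Record set_structure : Type := SetStructure {
  sets :> Type;
  mem : sets -> sets -> Prop
}.

Declare Scope zf_scope.
Delimit Scope zf_scope with zf.
Notation "x ∈ A" := (mem x A) (at level 70, no associativity) : zf_scope.
Open Scope zf_scope.

(* De Bruijn syntax: variable 0 is the one bound by the innermost quantifier. *)
Inductive formula : Type :=
| FMem (i j : nat)
| FEq (i j : nat)
| FFalse
| FImp (p q : formula)
| FAnd (p q : formula)
| FOr (p q : formula)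
| FAll (p : formula)
| FEx (p : formula).

Definition scons (T : Type) (x : T) (e : nat -> T) (n : nat) : T :=
  match n with
  | O => x
  | S m => e m
  end.

Fixpoint sat (M : set_structure) (e : nat -> M) (p : formula) : Prop :=
  match p with
  | FMem i j => e i ∈ e j
  | FEq i j => e i = e j
  | FFalse => False
  | FImp p q => sat e p -> sat e q
  | FAnd p q => sat e p /\ sat e q
  | FOr p q => sat e p \/ sat e q
  | FAll p => forall x : M, sat (scons x e) p
  | FEx p => exists x : M, sat (scons x e) p
  end.

Record ZF (M : set_structure) : Prop := {
  zf_extensionality : forall A B : M, (forall x : M, x ∈ A <-> x ∈ B) -> A = B;
  zf_foundation : forall A : M, (exists x : M, x ∈ A) ->
    exists x : M, x ∈ A /\ forall y : M, y ∈ A -> ~ y ∈ x;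
  zf_pairing : forall a b : M,
    exists c : M, forall x : M, x ∈ c <-> x = a \/ x = b;
  zf_union : forall A : M,
    exists U : M, forall x : M, x ∈ U <-> exists B : M, B ∈ A /\ x ∈ B;
  zf_powerset : forall A : M,
    exists P : M, forall B : M, B ∈ P <-> forall x : M, x ∈ B -> x ∈ A;
  zf_infinity : exists W : M,
    (exists o : M, o ∈ W /\ forall x : M, ~ x ∈ o) /\
    (forall n : M, n ∈ W ->
       exists s : M, s ∈ W /\ forall x : M, x ∈ s <-> x ∈ n \/ x = n);
  zf_separation : forall (p : formula) (e : nat -> M) (A : M),
    exists B : M, forall x : M, x ∈ B <-> x ∈ A /\ sat (scons x e) p;
  zf_replacement : forall (p : formula) (e : nat -> M) (A : M),
    (forall x : M, x ∈ A -> exists! y : M, sat (scons x (scons y e)) p) ->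
    exists B : M, forall y : M,
      y ∈ B <-> exists x : M, x ∈ A /\ sat (scons x (scons y e)) p
}.

Definition is_upair (M : set_structure) (c a b : M) : Prop :=
  forall x : M, x ∈ c <-> x = a \/ x = b.

(* Kuratowski: p = {{a}, {a, b}}. *)
Definition is_pair (M : set_structure) (p a b : M) : Prop :=
  exists s t : M, is_upair s a a /\ is_upair t a b /\ is_upair p s t.

Definition is_product (M : set_structure) (P A B : M) : Prop :=
  forall p : M, p ∈ P <-> exists a b : M, a ∈ A /\ b ∈ B /\ is_pair p a b.

(* f(x) = y, resp. f(x, y) = z, where f is a graph. *)
Definition app (M : set_structure) (f x y : M) : Prop :=
  exists p : M, is_pair p x y /\ p ∈ f.

Definition app2 (M : set_structure) (f x y z : M) : Prop :=
  exists p : M, is_pair p x y /\ app f p z.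

Definition is_fun (M : set_structure) (f A B : M) : Prop :=
  (forall p : M, p ∈ f -> exists x y : M, x ∈ A /\ y ∈ B /\ is_pair p x y) /\
  (forall x : M, x ∈ A -> exists! y : M, app f x y).

Definition is_fun2 (M : set_structure) (f A B C : M) : Prop :=
  exists P : M, is_product P A B /\ is_fun f P C.

(* Since operations are sets, an identity such as x + (y + z) = (x + y) + z is
   stated by naming the intermediate values and the common result r. *)
Record is_abelian_group (M : set_structure) (A add zero : M) : Prop := {
  add_fun : is_fun2 add A A A;
  add_assoc : forall x y z : M, x ∈ A -> y ∈ A -> z ∈ A ->
    exists xy yz r : M, app2 add x y xy /\ app2 add y z yz /\
                        app2 add xy z r /\ app2 add x yz r;
  add_comm : forall x y : M, x ∈ A -> y ∈ A ->
    exists r : M, app2 add x y r /\ app2 add y x r;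
  zero_in : zero ∈ A;
  add_zero : forall x : M, x ∈ A -> app2 add zero x x;
  add_opp : forall x : M, x ∈ A -> exists y : M, y ∈ A /\ app2 add x y zero
}.

Record field_data (M : set_structure) : Type := FieldData {
  fcarrier : M;
  fadd : M;
  fzero : M;
  fmul : M;
  fone : M
}.

Record is_field (M : set_structure) (K : field_data M) : Prop := {
  field_add : is_abelian_group (fcarrier K) (fadd K) (fzero K);
  mul_fun : is_fun2 (fmul K) (fcarrier K) (fcarrier K) (fcarrier K);
  mul_assoc : forall x y z : M,
    x ∈ fcarrier K -> y ∈ fcarrier K -> z ∈ fcarrier K ->
    exists xy yz r : M, app2 (fmul K) x y xy /\ app2 (fmul K) y z yz /\
                        app2 (fmul K) xy z r /\ app2 (fmul K) x yz r;
  mul_comm : forall x y : M, x ∈ fcarrier K -> y ∈ fcarrier K ->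
    exists r : M, app2 (fmul K) x y r /\ app2 (fmul K) y x r;
  one_in : fone K ∈ fcarrier K;
  mul_one : forall x : M, x ∈ fcarrier K -> app2 (fmul K) (fone K) x x;
  mul_add : forall x y z : M,
    x ∈ fcarrier K -> y ∈ fcarrier K -> z ∈ fcarrier K ->
    exists s xy xz r : M, app2 (fadd K) y z s /\ app2 (fmul K) x s r /\
                          app2 (fmul K) x y xy /\ app2 (fmul K) x z xz /\
                          app2 (fadd K) xy xz r;
  one_neq_zero : fone K <> fzero K;
  mul_inv : forall x : M, x ∈ fcarrier K -> x <> fzero K ->
    exists y : M, y ∈ fcarrier K /\ app2 (fmul K) x y (fone K)
}.

Record vspace_data (M : set_structure) : Type := VspaceData {
  vcarrier : M;
  vadd : M;
  vzero : M;
  vscal : M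
}.

Record is_vspace (M : set_structure) (K : field_data M) (E : vspace_data M) :
    Prop := {
  vspace_add : is_abelian_group (vcarrier E) (vadd E) (vzero E);
  scal_fun : is_fun2 (vscal E) (fcarrier K) (vcarrier E) (vcarrier E);
  scal_assoc : forall a b x : M,
    a ∈ fcarrier K -> b ∈ fcarrier K -> x ∈ vcarrier E ->
    exists ab bx r : M, app2 (fmul K) a b ab /\ app2 (vscal E) b x bx /\
                        app2 (vscal E) ab x r /\ app2 (vscal E) a bx r;
  scal_one : forall x : M, x ∈ vcarrier E -> app2 (vscal E) (fone K) x x;
  scal_add_r : forall a x y : M,
    a ∈ fcarrier K -> x ∈ vcarrier E -> y ∈ vcarrier E ->
    exists s ax ay r : M, app2 (vadd E) x y s /\ app2 (vscal E) a s r /\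
                          app2 (vscal E) a x ax /\ app2 (vscal E) a y ay /\
                          app2 (vadd E) ax ay r;
  scal_add_l : forall a b x : M,
    a ∈ fcarrier K -> b ∈ fcarrier K -> x ∈ vcarrier E ->
    exists s ax bx r : M, app2 (fadd K) a b s /\ app2 (vscal E) s x r /\
                          app2 (vscal E) a x ax /\ app2 (vscal E) b x bx /\
                          app2 (vadd E) ax bx r
}.

Definition vspace_of_field (M : set_structure) (K : field_data M) :
    vspace_data M :=
  VspaceData (fcarrier K) (fadd K) (fzero K) (fmul K).

Definition non_null_vspace (M : set_structure) (E : vspace_data M) : Prop :=
  exists x : M, x ∈ vcarrier E /\ x <> vzero E.

Record is_subspace (M : set_structure) (K : field_data M)
    (F E : vspace_data M) : Prop := {
  subspace_vspace : is_vspace K F;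
  subspace_incl : forall x : M, x ∈ vcarrier F -> x ∈ vcarrier E;
  subspace_add : forall x y z : M, x ∈ vcarrier F -> y ∈ vcarrier F ->
    app2 (vadd F) x y z -> app2 (vadd E) x y z;
  subspace_scal : forall a x z : M, a ∈ fcarrier K -> x ∈ vcarrier F ->
    app2 (vscal F) a x z -> app2 (vscal E) a x z
}.

Record is_linear (M : set_structure) (K : field_data M)
    (E E' : vspace_data M) (f : M) : Prop := {
  linear_fun : is_fun f (vcarrier E) (vcarrier E');
  linear_add : forall x y : M, x ∈ vcarrier E -> y ∈ vcarrier E ->
    exists s fx fy r : M, app2 (vadd E) x y s /\ app f s r /\
                          app f x fx /\ app f y fy /\ app2 (vadd E') fx fy r;
  linear_scal : forall a x : M, a ∈ fcarrier K -> x ∈ vcarrier E ->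
    exists s fx r : M, app2 (vscal E) a x s /\ app f s r /\
                       app f x fx /\ app2 (vscal E') a fx r
}.

Definition is_linear_form (M : set_structure) (K : field_data M)
    (E : vspace_data M) (f : M) : Prop :=
  is_linear K E (vspace_of_field K) f.

Definition non_null_form (M : set_structure) (K : field_data M)
    (E : vspace_data M) (f : M) : Prop :=
  exists x y : M, x ∈ vcarrier E /\ app f x y /\ y <> fzero K.

(* Es is the algebraic dual of E, with its pointwise operations. *)
Record is_dual (M : set_structure) (K : field_data M)
    (E Es : vspace_data M) : Prop := {
  dual_vspace : is_vspace K Es;
  dual_carrier : forall f : M, f ∈ vcarrier Es <-> is_linear_form K E f;
  dual_add : forall f g h x : M, f ∈ vcarrier Es -> g ∈ vcarrier Es ->
    app2 (vadd Es) f g h -> x ∈ vcarrier E ->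
    exists fx gx r : M, app f x fx /\ app g x gx /\
                        app2 (fadd K) fx gx r /\ app h x r;
  dual_scal : forall a f h x : M, a ∈ fcarrier K -> f ∈ vcarrier Es ->
    app2 (vscal Es) a f h -> x ∈ vcarrier E ->
    exists fx r : M, app f x fx /\ app2 (fmul K) a fx r /\ app h x r
}.

Definition extends (M : set_structure) (g f : M) : Prop :=
  forall x y : M, app f x y -> app g x y.

Definition D (M : set_structure) (K : field_data M) : Prop :=
  forall E : vspace_data M, is_vspace K E -> non_null_vspace E ->
  exists f : M, is_linear_form K E f /\ non_null_form K E f.

(* The existential quantifiers over Fs and Es only name the duals, which exist
   and are unique in ZF. *)
Definition LE (M : set_structure) (K : field_data M) : Prop :=
  forall E F : vspace_data M, is_vspace K E -> is_subspace K F E ->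
  exists Fs Es : vspace_data M, is_dual K F Fs /\ is_dual K E Es /\
  exists T : M, is_linear K Fs Es T /\
    forall f : M, f ∈ vcarrier Fs -> exists g : M, app T f g /\ extends g f.

(* Main.v *)
Require Import Defs.
From Stdlib Require Import ClassicalEpsilon PeanoNat.

(** The direction LE => D extends the coordinate form of the line through a
    nonzero vector.

    For D => LE, let X be the poset of subspaces W of E with W ∩ F = 0. Each W
    projects F + W onto F, and every vector of E lies in F + W for a dense set
    of W, since a line can be added to W otherwise. Say that a property holds
    eventually when the W above which it always holds are dense, and let A be
    the quotient of K^X by eventual equality, a non-null space. For f in F* and
    e in E, the function W |-> f (projection of e along W) defines an element
    ev(f,e) of the algebra A that is bilinear in (f,e) and equal to the
    constant f(e) for e in F. If phi is a form on A with phi(u) = 1, then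
    T(f)(e) := phi (u * ev(f,e)) is a linear extender.

    Definability is handled semantically: [def P] says that a predicate on
    environments is given by a formula with parameters. *)

(** * Definability with parameters *)

(** A linear complement of F would give an extender at once, by composition with the projection, but
    ZF does not provide one. All partial complements W are therefore used simultaneously, and the
    form phi plays the part of a limit along them; as phi depends neither on f nor on e, one
    application of [D] extends all forms on F together. The poset X is not directed: the sum of two
    subspaces that avoid F may meet F, and then no member of X lies above both. Tails above single
    members thus do not generate a proper filter, and density takes their place. No choice of the
    metatheory leaks into M. Sets of M are obtained from the axioms alone, with formulas in the
    schemata, and the description operator that names them returns an element determined by its
    defining property. This is why each construction comes with a proof of definability. *)

Section Formulas.
Context {M : set_structure}.
Implicit Types (e c : nat -> M) (P Q : (nat -> M) -> Prop) (t : (nat -> M) -> M).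

Lemma sat_ext e e' p : (forall i, e i = e' i) -> sat e p <-> sat e' p.
Proof.
  revert e e'; induction p; intros e e' H; simpl; rewrite ?H;
    try rewrite (IHp1 e e' H), (IHp2 e e' H); try tauto.
  - assert (K : forall x, sat (scons x e) p <-> sat (scons x e') p).
    { intros x; apply IHp; intros [|i]; simpl; auto. }
    split; intros A x; apply K, A.
  - assert (K : forall x, sat (scons x e) p <-> sat (scons x e') p).
    { intros x; apply IHp; intros [|i]; simpl; auto. }
    split; intros [x A]; exists x; apply K, A.
Qed.

Definition up (r : nat -> nat) (i : nat) : nat :=
  match i with O => O | S j => S (r j) end.

Fixpoint ren (r : nat -> nat) (p : formula) : formula :=
  match p with
  | FMem i j => FMem (r i) (r j)
  | FEq i j => FEq (r i) (r j)
  | FFalse => FFalse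
  | FImp p q => FImp (ren r p) (ren r q)
  | FAnd p q => FAnd (ren r p) (ren r q)
  | FOr p q => FOr (ren r p) (ren r q)
  | FAll p => FAll (ren (up r) p)
  | FEx p => FEx (ren (up r) p)
  end.

Lemma sat_ren r e p : sat e (ren r p) <-> sat (fun i => e (r i)) p.
Proof.
  revert r e; induction p; intros r e; simpl; try tauto;
    try (rewrite IHp1, IHp2; tauto).
  - assert (K : forall x, sat (scons x e) (ren (up r) p) <->
                          sat (scons x (fun i => e (r i))) p).
    { intros x; rewrite IHp; apply sat_ext; intros [|i]; reflexivity. }
    split; intros A x; apply K, A.
  - assert (K : forall x, sat (scons x e) (ren (up r) p) <->
                          sat (scons x (fun i => e (r i))) p).
    { intros x; rewrite IHp; apply sat_ext; intros [|i]; reflexivity. }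
    split; intros [x A]; exists x; apply K, A.
Qed.

(* Even positions hold the variables, odd positions the parameters. *)
Fixpoint mix e c (i : nat) : M :=
  match i with
  | O => e O
  | S j => mix c (fun k => e (S k)) j
  end.

Lemma mix_even i : forall e c, mix e c (2 * i) = e i.
Proof.
  induction i; intros e c; [reflexivity|].
  replace (2 * S i) with (S (S (2 * i))) by (simpl; rewrite Nat.add_succ_r; reflexivity).
  simpl mix at 1. exact (IHi (fun k => e (S k)) (fun k => c (S k))).
Qed.

(** Removing the first entry of a mixture exchanges the roles of the two environments, so the even
    case applies to the exchanged pair. *)
Lemma mix_odd i e c : mix e c (S (2 * i)) = c i.
Proof. exact (mix_even i c (fun k => e (S k))). Qed.

Lemma mix_ind (R : nat -> Prop) :
  (forall i, R (2 * i)) -> (forall i, R (S (2 * i))) -> forall n, R n.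
Proof.
  intros H0 H1 n; destruct (Nat.Even_or_Odd n) as [[i ->]|[i ->]]; auto.
  rewrite Nat.add_1_r; auto.
Qed.

(** Variables and parameters sit at positions of different parity, so a renaming is specified by its
    effect on each kind. *)
Lemma parity_cases (f g : nat -> nat) :
  exists r, forall i, r (2 * i) = f i /\ r (S (2 * i)) = g i.
Proof.
  exists (fun n => if Nat.even n then f (Nat.div2 n) else g (Nat.div2 n)).
  intros i. rewrite Nat.even_even, Nat.div2_even, <- Nat.add_1_r, Nat.even_odd,
    Nat.div2_odd'. auto.
Qed.

(** A formula mentions finitely many parameters; an infinite list is kept so that two lists can be
    interleaved into one. *)
Definition def P : Prop := exists p c, forall e, sat (mix e c) p <-> P e.

Lemma def_iff P Q : (forall e, P e <-> Q e) -> def P -> def Q.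
Proof. intros H [p [c K]]; exists p, c; intros e; rewrite K; apply H. Qed.

Lemma def_ren (s : nat -> nat) P : def P -> def (fun e => P (fun i => e (s i))).
Proof.
  intros [p [c K]].
  destruct (parity_cases (fun i => 2 * s i) (fun i => S (2 * i))) as [r Hr].
  exists (ren r p), c; intros e; rewrite sat_ren, <- K.
  apply sat_ext; apply mix_ind; intros i; destruct (Hr i) as [Hr0 Hr1];
    rewrite ?Hr0, ?Hr1, ?mix_odd, ?mix_even; reflexivity.
Qed.

(** The two parameter lists are interleaved by [mix c d]: parameter i of the first formula becomes
    parameter 2i, that of the second becomes 2i+1, while the variables stay in place. *)
Lemma def_common_params P Q : def P -> def Q ->
  exists p q c, (forall e, sat (mix e c) p <-> P e) /\ (forall e, sat (mix e c) q <-> Q e).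
Proof.
  intros [p [c K]] [q [d L]].
  destruct (parity_cases (fun i => 2 * i) (fun i => S (2 * (2 * i)))) as [r Hr].
  destruct (parity_cases (fun i => 2 * i) (fun i => S (2 * S (2 * i)))) as [s Hs].
  exists (ren r p), (ren s q), (mix c d); split; intros e; rewrite sat_ren.
  - rewrite <- K; apply sat_ext; apply mix_ind; intros i;
      destruct (Hr i) as [Hr0 Hr1];
      rewrite ?Hr0, ?Hr1, ?mix_odd, ?mix_even; reflexivity.
  - rewrite <- L; apply sat_ext; apply mix_ind; intros i;
      destruct (Hs i) as [Hr0 Hr1];
      rewrite ?Hr0, ?Hr1, ?mix_odd, ?mix_even; reflexivity.
Qed.

Lemma def_and P Q : def P -> def Q -> def (fun e => P e /\ Q e).
Proof.
  intros HP HQ; destruct (def_common_params P Q HP HQ) as [p [q [c [K L]]]].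
  exists (FAnd p q), c; intros e; simpl; rewrite K, L; tauto.
Qed.

Lemma def_or P Q : def P -> def Q -> def (fun e => P e \/ Q e).
Proof.
  intros HP HQ; destruct (def_common_params P Q HP HQ) as [p [q [c [K L]]]].
  exists (FOr p q), c; intros e; simpl; rewrite K, L; tauto.
Qed.

Lemma def_imp P Q : def P -> def Q -> def (fun e => P e -> Q e).
Proof.
  intros HP HQ; destruct (def_common_params P Q HP HQ) as [p [q [c [K L]]]].
  exists (FImp p q), c; intros e; simpl; rewrite K, L; tauto.
Qed.

Lemma def_iff2 P Q : def P -> def Q -> def (fun e => P e <-> Q e).
Proof. intros; apply def_and; apply def_imp; assumption. Qed.

(** A quantifier puts its variable in front of the whole mixture, which pushes the other variables
    to odd positions; the reindexing restores the parity, with the bound variable as variable 0. *)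
Lemma scons_mix_reindex :
  exists r, forall x e c i, scons x (mix e c) (r i) = mix (scons x e) c i.
Proof.
  destruct (parity_cases (fun i => match i with O => O | S k => S (2 * k) end)
              (fun i => S (S (2 * i)))) as [r Hr].
  exists r; intros x e c; apply mix_ind; intros i; destruct (Hr i) as [Hr0 Hr1];
    rewrite ?Hr0, ?Hr1, ?mix_odd, ?mix_even.
  - destruct i as [|i]; [reflexivity|exact (mix_even i e c)].
  - exact (mix_odd i e c).
Qed.

Lemma def_ex (R : (nat -> M) -> M -> Prop) :
  def (fun e => R (fun i => e (S i)) (e 0)) -> def (fun e => exists x, R e x).
Proof.
  intros [p [c K]]; destruct scons_mix_reindex as [r Hr].
  exists (FEx (ren r p)), c; intros e; simpl.
  assert (L : forall x, sat (scons x (mix e c)) (ren r p) <-> R e x).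
  { intros x; rewrite sat_ren, (sat_ext _ _ p (Hr x e c)), K; reflexivity. }
  split; intros [x A]; exists x; apply L, A.
Qed.

Lemma def_all (R : (nat -> M) -> M -> Prop) :
  def (fun e => R (fun i => e (S i)) (e 0)) -> def (fun e => forall x, R e x).
Proof.
  intros [p [c K]]; destruct scons_mix_reindex as [r Hr].
  exists (FAll (ren r p)), c; intros e; simpl.
  assert (L : forall x, sat (scons x (mix e c)) (ren r p) <-> R e x).
  { intros x; rewrite sat_ren, (sat_ext _ _ p (Hr x e c)), K; reflexivity. }
  split; intros A x; apply L, A.
Qed.

(** The language has no function symbols, so a term is definable through its graph, with the value
    in variable 0. *)
Definition tdef t : Prop := def (fun e => e 0 = t (fun i => e (S i))).

Lemma def_eq_vars (x0 : M) i j : def (fun e => e i = e j).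
Proof.
  exists (FEq (2 * i) (2 * j)), (fun _ => x0); intros e; unfold sat.
  rewrite !mix_even; reflexivity.
Qed.

Lemma def_mem_vars (x0 : M) i j : def (fun e => e i ∈ e j).
Proof.
  exists (FMem (2 * i) (2 * j)), (fun _ => x0); intros e; unfold sat.
  rewrite !mix_even; reflexivity.
Qed.

Lemma tdef_const (m : M) : tdef (fun _ => m).
Proof. exists (FEq 0 1), (fun _ => m); intros e; simpl; reflexivity. Qed.

Lemma def_subst (R : M -> (nat -> M) -> Prop) t :
  tdef t -> def (fun e => R (e 0) (fun i => e (S i))) ->
  def (fun e => R (t e) e).
Proof.
  intros Ht HR.
  apply def_iff with (P := fun e => exists x, x = t e /\ R x e).
  - intros e; split; [intros [x [-> H]]; exact H | eauto].
  - apply def_ex, def_and; assumption.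
Qed.

Lemma tdef_shift t : tdef t -> tdef (fun e => t (fun i => e (S i))).
Proof.
  intros H. exact (def_ren (fun i => match i with O => O | S k => S (S k) end) _ H).
Qed.

Lemma tdef_shift2 t : tdef t -> tdef (fun e => t (fun i => e (S (S i)))).
Proof.
  intros H.
  exact (def_ren (fun i => match i with O => O | S k => S (S (S k)) end) _ H).
Qed.

Lemma tdef_app1 (s : M -> M) t : tdef (fun e => s (e 0)) -> tdef t ->
  tdef (fun e => s (t e)).
Proof.
  intros Hs Ht; unfold tdef.
  apply (def_subst (fun y e => e 0 = s y) (fun e => t (fun i => e (S i)))).
  - apply tdef_shift, Ht.
  - exact (def_ren (fun i => match i with O => 1 | S _ => O end) _ Hs).
Qed.

Lemma tdef_app2 (s : M -> M -> M) t u : tdef (fun e => s (e 0) (e 1)) ->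
  tdef t -> tdef u -> tdef (fun e => s (t e) (u e)).
Proof.
  intros Hs Ht Hu; unfold tdef.
  apply (def_subst (fun y e => e 0 = s y (u (fun i => e (S i))))
           (fun e => t (fun i => e (S i)))); [apply tdef_shift, Ht|].
  apply (def_subst (fun z e => e 1 = s (e 0) z) (fun e => u (fun i => e (S (S i)))));
    [apply tdef_shift2, Hu|].
  exact (def_ren (fun i => match i with O => 2 | 1 => 1 | _ => O end) _ Hs).
Qed.

End Formulas.

(** * Unique description and the axiom schemata for definable predicates *)

Section Model.
Context {M : set_structure} (HM : ZF M).
Implicit Types e : nat -> M.

Lemma ZF_point : exists x : M, True.
Proof. destruct (zf_infinity HM) as [W _]; eauto. Qed.

Lemma tdef_var i : tdef (fun e : nat -> M => e i).
Proof. destruct ZF_point as [x0 _]; exact (def_eq_vars x0 0 (S i)). Qed.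

(** By excluded middle the proposition is equivalent to a valid formula or to [FFalse]; it may be
    any statement of the metatheory that does not depend on the environment. *)
Lemma def_const (A : Prop) : def (fun _ : nat -> M => A).
Proof.
  destruct ZF_point as [x0 _]; destruct (classic A) as [HA|HA].
  - exists (FEq 0 0), (fun _ => x0); simpl; tauto.
  - exists FFalse, (fun _ => x0); simpl; tauto.
Qed.

Lemma def_mem (t u : (nat -> M) -> M) : tdef t -> tdef u -> def (fun e => t e ∈ u e).
Proof.
  intros Ht Hu; destruct ZF_point as [x0 _].
  apply (def_subst (fun x e => x ∈ u e)); [assumption|].
  apply (def_subst (fun y e => e 0 ∈ y)); [apply tdef_shift, Hu|].
  exact (def_mem_vars x0 1 0).
Qed.

Lemma def_eq (t u : (nat -> M) -> M) : tdef t -> tdef u -> def (fun e => t e = u e).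
Proof.
  intros Ht Hu; destruct ZF_point as [x0 _].
  apply (def_subst (fun x e => x = u e)); [assumption|].
  apply (def_subst (fun y e => e 0 = y)); [apply tdef_shift, Hu|].
  exact (def_eq_vars x0 1 0).
Qed.

(** The default in the second case makes the description total as well as unique, so that its graph
    is again first-order and terms built from it stay definable. *)
Definition is_iota (P : M -> Prop) (y : M) : Prop :=
  (P y /\ forall z, P z -> z = y) \/
  (~ (exists x, P x /\ forall z, P z -> z = x) /\ forall x, ~ x ∈ y).

Lemma empty_ex : exists o : M, forall x, ~ x ∈ o.
Proof. destruct (zf_infinity HM) as [W [[o [_ H]] _]]; eauto. Qed.

Lemma is_iota_ex (P : M -> Prop) : exists y, is_iota P y.
Proof.
  destruct (classic (exists x, P x /\ forall z, P z -> z = x)) as [[x H]|H].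
  - exists x; left; exact H.
  - destruct empty_ex as [o Ho]; exists o; right; auto.
Qed.

(* The empty set when [P] does not hold of exactly one element. *)
Definition iota (P : M -> Prop) : M :=
  proj1_sig (constructive_indefinite_description _ (is_iota_ex P)).

Lemma iota_spec (P : M -> Prop) : is_iota P (iota P).
Proof. unfold iota; destruct constructive_indefinite_description; assumption. Qed.

Lemma iota_eq (P : M -> Prop) x : P x -> (forall z, P z -> z = x) -> iota P = x.
Proof.
  intros Hx U; destruct (iota_spec P) as [[H _]|[H _]]; [apply U, H|].
  exfalso; apply H; eauto.
Qed.

(** Uniqueness makes the choice operator inside [iota] harmless: the element it returns is
    determined by [P], and the default by extensionality. *)
Lemma is_iota_unique (P : M -> Prop) y z : is_iota P y -> is_iota P z -> y = z.
Proof.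
  unfold is_iota; intros [[H H']|[H H']] [[K K']|[K K']]; auto.
  - exfalso; apply K; eauto.
  - exfalso; apply H; eauto.
  - apply (zf_extensionality HM); intros x; split; intros L; exfalso;
      [apply (H' x L)|apply (K' x L)].
Qed.

Lemma tdef_iota (R : (nat -> M) -> M -> Prop) :
  def (fun e => R (fun i => e (S i)) (e 0)) -> tdef (fun e => iota (R e)).
Proof.
  intros H; unfold tdef.
  apply def_iff with (P := fun e => is_iota (R (fun i => e (S i))) (e 0)).
  - intros e; split; intros K.
    + exact (is_iota_unique _ _ _ K (iota_spec _)).
    + rewrite K; apply iota_spec.
  - assert (H' : forall s : nat -> nat, def (fun e => R (fun i => e (s (S i))) (e (s 0)))).
    { intros s; exact (def_ren s _ H). }
    assert (E : forall i j, def (fun e => e i = e j)).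
    { intros; apply (def_eq (fun e => e i) (fun e => e j)); apply tdef_var. }
    assert (B : forall i j, def (fun e => e i ∈ e j)).
    { intros; apply (def_mem (fun e => e i) (fun e => e j)); apply tdef_var. }
    unfold is_iota, not.
    apply def_or; apply def_and.
    + exact (H' (fun i => i)).
    + apply def_all, def_imp; [|apply E].
      exact (H' (fun i => match i with O => O | S k => S (S k) end)).
    + apply def_imp; [|apply def_const]. apply def_ex, def_and.
      * exact (H' (fun i => match i with O => O | S k => S (S k) end)).
      * apply def_all, def_imp; [|apply E].
        exact (H' (fun i => match i with O => O | S k => S (S (S k)) end)).
    + apply def_all, def_imp; [apply B|apply def_const].
Qed.

Lemma separation (P : M -> Prop) A : def (fun e => P (e 0)) ->
  exists B : M, forall x, x ∈ B <-> x ∈ A /\ P x.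
Proof.
  intros [p [c K]]; destruct ZF_point as [x0 _]; destruct (scons_mix_reindex (M := M)) as [r Hr].
  destruct (zf_separation HM (ren r p) (mix (fun _ => x0) c) A) as [B HB].
  exists B; intros x; rewrite HB, sat_ren, (sat_ext _ _ p (Hr x _ c)), K; reflexivity.
Qed.

Lemma replacement (t : M -> M) A : tdef (fun e => t (e 0)) ->
  exists B : M, forall y, y ∈ B <-> exists x, x ∈ A /\ y = t x.
Proof.
  intros Ht; destruct ZF_point as [x0 _]; destruct (scons_mix_reindex (M := M)) as [r Hr].
  assert (Hs : def (fun e => e 1 = t (e 0))).
  { exact (def_ren (fun i => match i with O => 1 | S _ => O end) _ Ht). }
  destruct Hs as [p [c K]].
  (* In the replacement schema both the argument and the value stand in front of the mixture: [up r]
     absorbs the value, and [r] then absorbs the argument. *)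
  set (q := ren (up r) (ren r p)). set (e := mix (fun _ => x0) c).
  assert (L : forall x y, sat (scons x (scons y e)) q <-> y = t x).
  { intros x y; unfold q, e; rewrite !sat_ren.
    rewrite <- (K (scons x (scons y (fun _ => x0)))); apply sat_ext; intros i.
    rewrite <- (Hr x _ c); destruct (r i); simpl; [reflexivity|].
    exact (Hr y _ c _). }
  destruct (zf_replacement HM (p:=q) (e:=e) (A:=A)) as [B HB].
  - intros x _; exists (t x); split; [apply L; reflexivity|].
    intros y Hy; symmetry; apply L, Hy.
  - exists B; intros y; rewrite HB; split; intros [x [Hx Hy]]; exists x;
      (split; [assumption|apply L, Hy]).
Qed.

Lemma def_not (A : (nat -> M) -> Prop) : def A -> def (fun e => ~ A e).
Proof. intros H; apply def_imp; [exact H|apply def_const]. Qed.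

Definition setof (A : M -> Prop) : M := iota (fun B => forall x, x ∈ B <-> A x).

Lemma setof_spec (A : M -> Prop) : (exists B, forall x, x ∈ B <-> A x) ->
  forall x, x ∈ setof A <-> A x.
Proof.
  intros [B HB]. enough (E : setof A = B) by (rewrite E; exact HB).
  apply iota_eq; [exact HB|].
  intros C HC; apply (zf_extensionality HM); intros x; rewrite HC, HB; reflexivity.
Qed.

Lemma tdef_setof (R : (nat -> M) -> M -> Prop) :
  def (fun e => R (fun i => e (S i)) (e 0)) -> tdef (fun e => setof (R e)).
Proof.
  intros H; apply tdef_iota, def_all, def_iff2.
  - apply def_mem; apply tdef_var.
  - exact (def_ren (fun i => match i with O => O | S k => S (S k) end) _ H).
Qed.

(** * Pairs, functions and products *)

Definition upair (a b : M) : M := setof (fun x => x = a \/ x = b).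
Definition opair (a b : M) : M := upair (upair a a) (upair a b).
Definition union (A : M) : M := setof (fun x => exists B, B ∈ A /\ x ∈ B).
Definition power (A : M) : M := setof (fun B => forall x, x ∈ B -> x ∈ A).
Definition sep (A : M) (P : M -> Prop) : M := setof (fun x => x ∈ A /\ P x).
Definition image (A : M) (t : M -> M) : M :=
  setof (fun y => exists x, x ∈ A /\ y = t x).
Definition ap (f x : M) : M := iota (fun y => opair x y ∈ f).
Definition prod (A B : M) : M := union (image A (fun a => image B (opair a))).
Definition lam (A : M) (t : M -> M) : M := image A (fun x => opair x (t x)).
Definition fst (p : M) : M := iota (fun a => exists b, p = opair a b).
Definition snd (p : M) : M := iota (fun b => exists a, p = opair a b).
Definition op2 (f x y : M) : M := ap f (opair x y).
Definition lam2 (A B : M) (t : M -> M -> M) : M :=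
  lam (prod A B) (fun p => t (fst p) (snd p)).

Lemma tdef_upair a b : tdef a -> tdef b -> tdef (fun e => upair (a e) (b e)).
Proof.
  intros Ha Hb; unfold upair; apply tdef_setof, def_or; apply def_eq;
    try apply tdef_var; apply tdef_shift; assumption.
Qed.

Lemma tdef_opair a b : tdef a -> tdef b -> tdef (fun e => opair (a e) (b e)).
Proof. intros Ha Hb; apply tdef_upair; apply tdef_upair; assumption. Qed.

Lemma tdef_union a : tdef a -> tdef (fun e => union (a e)).
Proof.
  intros Ha; unfold union; apply tdef_setof, def_ex, def_and; apply def_mem;
    try apply tdef_var; apply tdef_shift2; assumption.
Qed.

Lemma tdef_ap f x : tdef f -> tdef x -> tdef (fun e => ap (f e) (x e)).
Proof.
  intros Hf Hx; unfold ap; apply tdef_iota, def_mem; [apply tdef_opair|];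
    try apply tdef_var; apply tdef_shift; assumption.
Qed.

Lemma tdef_image A (t : (nat -> M) -> M -> M) :
  tdef A -> tdef (fun e => t (fun i => e (S i)) (e 0)) ->
  tdef (fun e => image (A e) (t e)).
Proof.
  intros HA Ht; unfold image; apply tdef_setof, def_ex, def_and.
  - apply def_mem; [apply tdef_var|apply tdef_shift2, HA].
  - apply def_eq; [apply tdef_var|].
    exact (def_ren (fun i => match i with O => O | 1 => 1 | S (S k) => S (S (S k)) end)
             _ Ht).
Qed.

Lemma tdef_sep A (P : (nat -> M) -> M -> Prop) :
  tdef A -> def (fun e => P (fun i => e (S i)) (e 0)) ->
  tdef (fun e => sep (A e) (P e)).
Proof.
  intros HA HP; unfold sep; apply tdef_setof, def_and; [|exact HP].
  apply def_mem; [apply tdef_var|apply tdef_shift, HA].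
Qed.

Lemma tdef_lam A (t : (nat -> M) -> M -> M) :
  tdef A -> tdef (fun e => t (fun i => e (S i)) (e 0)) ->
  tdef (fun e => lam (A e) (t e)).
Proof.
  intros HA Ht; apply tdef_image; [exact HA|].
  apply tdef_opair; [apply tdef_var|exact Ht].
Qed.

Lemma tdef_fst p : tdef p -> tdef (fun e => fst (p e)).
Proof.
  intros Hp; apply tdef_iota, def_ex, def_eq; [|apply tdef_opair; apply tdef_var].
  apply tdef_shift2, Hp.
Qed.

Lemma tdef_snd p : tdef p -> tdef (fun e => snd (p e)).
Proof.
  intros Hp; apply tdef_iota, def_ex, def_eq; [|apply tdef_opair; apply tdef_var].
  apply tdef_shift2, Hp.
Qed.

Lemma tdef_op2 f x y : tdef f -> tdef x -> tdef y ->
  tdef (fun e => op2 (f e) (x e) (y e)).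
Proof. intros Hf Hx Hy; apply tdef_ap; [|apply tdef_opair]; assumption. Qed.

(** Definability follows by recursion on the shape of a predicate or term, one closure lemma per
    construct. The constant cases come first, so a subterm independent of the environment is a
    parameter whatever it contains. [dfn_atom] leaves room for notions introduced later. *)
Ltac dfn_atom := fail.
Ltac dfn :=
  cbv beta; lazymatch goal with
  | |- tdef (fun _ => ?a) => apply tdef_const
  | |- def (fun _ => ?A) => apply def_const
  | |- tdef (fun e => e _) => apply tdef_var
  | |- def (fun e => @?a e ∈ @?b e) => apply (def_mem a b); dfn
  | |- def (fun e => @?a e = @?b e) => apply (def_eq a b); dfn
  | |- def (fun e => @?A e /\ @?B e) => apply (def_and A B); dfn
  | |- def (fun e => @?A e \/ @?B e) => apply (def_or A B); dfn
  | |- def (fun e => @?A e <-> @?B e) => apply (def_iff2 A B); dfn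
  | |- def (fun e => ~ @?A e) => apply (def_not A); dfn
  | |- def (fun e => exists x : _, @?R e x) => apply (def_ex R); dfn
  | |- def (fun e => @?A e -> @?B e) => apply (def_imp A B); dfn
  | |- def (fun e => forall x : _, @?R e x) => apply (def_all R); dfn
  | |- tdef (fun e => iota (@?R e)) => apply (tdef_iota R); dfn
  | |- tdef (fun e => setof (@?R e)) => apply (tdef_setof R); dfn
  | |- tdef (fun e => upair (@?a e) (@?b e)) => apply (tdef_upair a b); dfn
  | |- tdef (fun e => opair (@?a e) (@?b e)) => apply (tdef_opair a b); dfn
  | |- tdef (fun e => union (@?a e)) => apply (tdef_union a); dfn
  | |- tdef (fun e => op2 (@?f e) (@?a e) (@?b e)) => apply (tdef_op2 f a b); dfn
  | |- tdef (fun e => ap (@?f e) (@?a e)) => apply (tdef_ap f a); dfn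
  | |- tdef (fun e => lam (@?A e) (@?t e)) => apply (tdef_lam A t); dfn
  | |- tdef (fun e => image (@?A e) (@?t e)) => apply (tdef_image A t); dfn
  | |- tdef (fun e => sep (@?A e) (@?P e)) => apply (tdef_sep A P); dfn
  | |- tdef (fun e => fst (@?a e)) => apply (tdef_fst a); dfn
  | |- tdef (fun e => snd (@?a e)) => apply (tdef_snd a); dfn
  | H : tdef (fun e => ?s (e 0)) |- tdef (fun e => ?s (@?a e)) =>
      apply (tdef_app1 s a H); dfn
  | H : tdef (fun e => ?s (e 0) (e 1)) |- tdef (fun e => ?s (@?a e) (@?b e)) =>
      apply (tdef_app2 s a b H); dfn
  | |- _ => dfn_atom
  end.

Lemma mem_upair x a b : x ∈ upair a b <-> x = a \/ x = b.
Proof. apply setof_spec, (zf_pairing HM). Qed.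

Lemma upair_eq p a b : is_upair p a b <-> p = upair a b.
Proof.
  split; [|intros ->; intros x; apply mem_upair].
  intros H; apply (zf_extensionality HM); intros x; rewrite mem_upair; apply H.
Qed.

Lemma pair_eq p a b : is_pair p a b <-> p = opair a b.
Proof.
  split.
  - intros [s [t [H1 [H2 H3]]]].
    rewrite upair_eq in H1, H2, H3; subst; reflexivity.
  - intros ->; exists (upair a a), (upair a b); rewrite !upair_eq; auto.
Qed.

Lemma upair_inj_l (a b c : M) : upair a b = upair a c -> b = c.
Proof.
  intros H.
  assert (B : b ∈ upair a c) by (rewrite <- H; apply mem_upair; auto).
  assert (C : c ∈ upair a b) by (rewrite H; apply mem_upair; auto).
  rewrite mem_upair in B, C; destruct B, C; congruence.
Qed.

Lemma opair_inj (a b c d : M) : opair a b = opair c d -> a = c /\ b = d.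
Proof.
  intros H.
  assert (E : a = c).
  { assert (C : upair a a ∈ opair c d) by (rewrite <- H; apply mem_upair; auto).
    assert (K : c ∈ upair a a).
    { apply mem_upair in C; destruct C as [-> | ->]; apply mem_upair; auto. }
    apply mem_upair in K; destruct K; auto. }
  subst c; split; [reflexivity|].
  (* A Kuratowski pair is an unordered pair with known first member, whose second member is again
     such a pair; two cancellations reach the second coordinate. *)
  apply (upair_inj_l a), (upair_inj_l (upair a a)), H.
Qed.

Lemma mem_union x A : x ∈ union A <-> exists B, B ∈ A /\ x ∈ B.
Proof. apply setof_spec, (zf_union HM). Qed.

Lemma mem_power B A : B ∈ power A <-> forall x, x ∈ B -> x ∈ A.
Proof. apply setof_spec, (zf_powerset HM). Qed.

Lemma mem_sep x A (P : M -> Prop) : def (fun e => P (e 0)) ->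
  x ∈ sep A P <-> x ∈ A /\ P x.
Proof. intros HP; apply setof_spec, separation, HP. Qed.

Lemma mem_image y A (t : M -> M) : tdef (fun e => t (e 0)) ->
  y ∈ image A t <-> exists x, x ∈ A /\ y = t x.
Proof. intros Ht; apply setof_spec, replacement, Ht. Qed.

Lemma mem_prod p A B : p ∈ prod A B <-> exists a b, a ∈ A /\ b ∈ B /\ p = opair a b.
Proof.
  unfold prod; rewrite mem_union; split.
  - intros [C [HC Hp]].
    apply mem_image in HC; [|dfn]. destruct HC as [a [Ha ->]].
    apply mem_image in Hp; [|dfn]. destruct Hp as [b [Hb ->]]. eauto 6.
  - intros [a [b [Ha [Hb ->]]]]; exists (image B (opair a)); split.
    + apply mem_image; [dfn|eauto].
    + apply mem_image; [dfn|eauto].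
Qed.

Lemma fst_opair a b : fst (opair a b) = a.
Proof.
  apply iota_eq; [eauto|]. intros z [c H]; apply opair_inj in H; symmetry; apply H.
Qed.

Lemma snd_opair a b : snd (opair a b) = b.
Proof.
  apply iota_eq; [eauto|]. intros z [c H]; apply opair_inj in H; symmetry; apply H.
Qed.

Lemma app_opair f x y : app f x y <-> opair x y ∈ f.
Proof.
  split.
  - intros [p [Hp H]]; rewrite pair_eq in Hp; subst p; exact H.
  - intros H; exists (opair x y); rewrite pair_eq; auto.
Qed.

Lemma app2_opair f x y z : app2 f x y z <-> app f (opair x y) z.
Proof.
  split.
  - intros [p [Hp H]]; rewrite pair_eq in Hp; subst p; exact H.
  - intros H; exists (opair x y); rewrite pair_eq; auto.
Qed.

(** This converts the relational axioms into equations: each intermediate value named there is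
    eliminated by substitution. *)
Lemma fun_app f A B x y : is_fun f A B -> x ∈ A -> app f x y <-> y = ap f x.
Proof.
  intros [_ Hf] Hx; destruct (Hf x Hx) as [z [Hz U]].
  assert (E : ap f x = z).
  { apply iota_eq; [apply app_opair, Hz|]. intros w Hw; symmetry; apply U, app_opair, Hw. }
  rewrite E; split; [intros H; symmetry; apply U, H|intros ->; exact Hz].
Qed.

Lemma fun_ap_in f A B x : is_fun f A B -> x ∈ A -> ap f x ∈ B.
Proof.
  intros Hf Hx.
  assert (H : app f x (ap f x)) by (apply (fun_app _ _ _ _ _ Hf Hx); reflexivity).
  destruct H as [p [Hp H]]; rewrite pair_eq in Hp; subst p.
  destruct Hf as [Hf _]; destruct (Hf _ H) as [x' [y [_ [Hy E]]]].
  rewrite pair_eq in E; apply opair_inj in E; destruct E as [_ ->]; exact Hy.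
Qed.

Lemma fun_sub f A B : is_fun f A B -> f ∈ power (prod A B).
Proof.
  intros [Hf _]; apply mem_power; intros p Hp; apply mem_prod.
  destruct (Hf p Hp) as [x [y [Hx [Hy E]]]]; rewrite pair_eq in E; eauto 6.
Qed.

Lemma fun_ext f g A B C : is_fun f A B -> is_fun g A C ->
  (forall x, x ∈ A -> ap f x = ap g x) -> f = g.
Proof.
  intros Hf Hg H; apply (zf_extensionality HM).
  assert (K : forall f g B C, is_fun f A B -> is_fun g A C ->
    (forall x, x ∈ A -> ap f x = ap g x) -> forall p, p ∈ f -> p ∈ g).
  { clear; intros f g B C Hf Hg H p Hp.
    destruct (proj1 Hf p Hp) as [x [y [Hx [Hy E]]]]; rewrite pair_eq in E; subst p.
    apply app_opair, (fun_app _ _ _ _ _ Hg Hx); rewrite <- H by assumption.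
    apply (fun_app _ _ _ _ _ Hf Hx), app_opair, Hp. }
  intros p; split; [apply (K f g B C)|apply (K g f C B)]; auto.
  intros x Hx; symmetry; auto.
Qed.

Lemma lam_fun A B (t : M -> M) : tdef (fun e => t (e 0)) ->
  (forall x, x ∈ A -> t x ∈ B) -> is_fun (lam A t) A B.
Proof.
  intros Ht HB.
  assert (L : forall p, p ∈ lam A t <-> exists x, x ∈ A /\ p = opair x (t x)).
  { intros p; apply mem_image; dfn; exact Ht. }
  split.
  - intros p Hp; apply L in Hp; destruct Hp as [x [Hx ->]].
    exists x, (t x); rewrite pair_eq; auto.
  - intros x Hx; exists (t x); split.
    + apply app_opair, L; eauto.
    + intros y Hy; apply app_opair, L in Hy; destruct Hy as [z [_ E]].
      apply opair_inj in E; destruct E as [-> ->]; reflexivity.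
Qed.

Lemma ap_lam (A : M) (t : M -> M) x : tdef (fun e => t (e 0)) -> x ∈ A ->
  ap (lam A t) x = t x.
Proof.
  intros Ht Hx. symmetry.
  assert (F : is_fun (lam A t) A (image A t)).
  { apply lam_fun; [exact Ht|]; intros z Hz; apply mem_image; eauto. }
  apply (fun_app _ _ _ _ _ F Hx), app_opair.
  apply mem_image; [dfn; exact Ht|eauto].
Qed.

Lemma product_eq p A B : is_product p A B <-> p = prod A B.
Proof.
  split.
  - intros H; apply (zf_extensionality HM); intros x; rewrite mem_prod, (H x).
    split; intros [a [b [Ha [Hb E]]]]; exists a, b; apply pair_eq in E || rewrite pair_eq;
      auto.
  - intros -> x; rewrite mem_prod.
    split; intros [a [b [Ha [Hb E]]]]; exists a, b; apply pair_eq in E || rewrite pair_eq;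
      auto.
Qed.

Lemma fun2_eq f A B C : is_fun2 f A B C <-> is_fun f (prod A B) C.
Proof.
  split.
  - intros [p [Hp H]]; apply product_eq in Hp; subst p; exact H.
  - intros H; exists (prod A B); rewrite product_eq; auto.
Qed.

Lemma opair_in_prod x y A B : x ∈ A -> y ∈ B -> opair x y ∈ prod A B.
Proof. intros; apply mem_prod; eauto 6. Qed.

Lemma fun2_app2 f A B C x y z : is_fun2 f A B C -> x ∈ A -> y ∈ B ->
  app2 f x y z <-> z = op2 f x y.
Proof.
  intros Hf Hx Hy; rewrite app2_opair; apply fun2_eq in Hf.
  exact (fun_app _ _ _ _ _ Hf (opair_in_prod _ _ _ _ Hx Hy)).
Qed.

Lemma fun2_in f A B C x y : is_fun2 f A B C -> x ∈ A -> y ∈ B -> op2 f x y ∈ C.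
Proof.
  intros Hf Hx Hy; apply fun2_eq in Hf.
  exact (fun_ap_in _ _ _ _ Hf (opair_in_prod _ _ _ _ Hx Hy)).
Qed.

Lemma lam2_fun2 A B C (t : M -> M -> M) : tdef (fun e => t (e 0) (e 1)) ->
  (forall x y, x ∈ A -> y ∈ B -> t x y ∈ C) -> is_fun2 (lam2 A B t) A B C.
Proof.
  intros Ht HC; apply fun2_eq, lam_fun; [dfn|].
  intros p Hp; apply mem_prod in Hp; destruct Hp as [x [y [Hx [Hy ->]]]].
  rewrite fst_opair, snd_opair; auto.
Qed.

Lemma op2_lam2 (A B : M) (t : M -> M -> M) x y : tdef (fun e => t (e 0) (e 1)) ->
  x ∈ A -> y ∈ B -> op2 (lam2 A B t) x y = t x y.
Proof.
  intros Ht Hx Hy; unfold op2, lam2; rewrite ap_lam.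
  - rewrite fst_opair, snd_opair; reflexivity.
  - dfn.
  - apply opair_in_prod; assumption.
Qed.

(** * Functional form of the algebraic structures *)

(** The operation is a function of the metatheory, constrained only on [A], so the laws are
    equations suitable for rewriting and can be verified for a term before its graph is formed. *)
Record group_ops (A : M) (add : M -> M -> M) (zero : M) : Prop := {
  g_in : forall x y, x ∈ A -> y ∈ A -> add x y ∈ A;
  g_assoc : forall x y z, x ∈ A -> y ∈ A -> z ∈ A ->
    add x (add y z) = add (add x y) z;
  g_comm : forall x y, x ∈ A -> y ∈ A -> add x y = add y x;
  g_zero_in : zero ∈ A;
  g_zero : forall x, x ∈ A -> add zero x = x;
  g_opp : forall x, x ∈ A -> exists y, y ∈ A /\ add x y = zero
}.

Lemma group_ops_ext A add add' zero :
  (forall x y, x ∈ A -> y ∈ A -> add x y = add' x y) ->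
  group_ops A add zero -> group_ops A add' zero.
Proof.
  intros E [H1 H2 H3 H4 H5 H6].
  constructor; try assumption.
  - intros; rewrite <- E; auto.
  - intros; rewrite <- !E; auto; rewrite <- E; auto.
  - intros; rewrite <- !E; auto; rewrite <- E; auto.
  - intros; rewrite <- E; auto.
  - intros x Hx; destruct (H6 x Hx) as [y [Hy K]]; exists y; rewrite <- E; auto.
Qed.

Lemma abelian_group_ops (A f zero : M) : is_abelian_group A f zero <->
  is_fun2 f A A A /\ group_ops A (op2 f) zero.
Proof.
  split.
  - intros [Hf H1 H2 H3 H4 H5].
    pose proof (fun x y z => fun2_app2 _ _ _ _ x y z Hf) as E.
    pose proof (fun x y => fun2_in _ _ _ _ x y Hf) as I.
    split; [exact Hf|]; constructor; auto.
    + intros x y z Hx Hy Hz; destruct (H1 x y z Hx Hy Hz) as [a [b [r [Ha [Hb [Hr Hs]]]]]].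
      apply E in Ha; auto; apply E in Hb; auto; subst.
      apply E in Hr; auto; apply E in Hs; auto; congruence.
    + intros x y Hx Hy; destruct (H2 x y Hx Hy) as [r [Ha Hb]].
      apply E in Ha; auto; apply E in Hb; auto; congruence.
    + intros x Hx; specialize (H4 x Hx); apply E in H4; auto.
    + intros x Hx; destruct (H5 x Hx) as [y [Hy K]]; apply E in K; eauto.
  - intros [Hf [H1 H2 H3 H4 H5 H6]].
    pose proof (fun x y z => fun2_app2 _ _ _ _ x y z Hf) as E.
    constructor; auto.
    + intros x y z Hx Hy Hz; exists (op2 f x y), (op2 f y z), (op2 f x (op2 f y z)).
      rewrite !E; auto.
    + intros x y Hx Hy; exists (op2 f x y); rewrite !E; auto.
    + intros x Hx; rewrite E; auto; rewrite H5; auto.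
    + intros x Hx; destruct (H6 x Hx) as [y [Hy K]]; exists y; rewrite E; auto.
Qed.

(* Otherwise unification and [auto] unfold set-theoretic terms without end. *)
Local Opaque iota setof upair opair union power sep image ap prod lam fst snd op2 lam2.

Section Algebra.
Context (K : field_data M) (HK : is_field K).

Definition kset : M := fcarrier K.
Definition kadd (x y : M) : M := op2 (fadd K) x y.
Definition kmul (x y : M) : M := op2 (fmul K) x y.

Record vspace_ops (V : M) (add : M -> M -> M) (zero : M) (sc : M -> M -> M) : Prop := {
  v_group : group_ops V add zero;
  v_in : forall a x, a ∈ kset -> x ∈ V -> sc a x ∈ V;
  v_assoc : forall a b x, a ∈ kset -> b ∈ kset -> x ∈ V ->
    sc (kmul a b) x = sc a (sc b x);
  v_one : forall x, x ∈ V -> sc (fone K) x = x;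
  v_add_r : forall a x y, a ∈ kset -> x ∈ V -> y ∈ V ->
    sc a (add x y) = add (sc a x) (sc a y);
  v_add_l : forall a b x, a ∈ kset -> b ∈ kset -> x ∈ V ->
    sc (kadd a b) x = add (sc a x) (sc b x)
}.

Lemma k_group : group_ops kset kadd (fzero K).
Proof. apply abelian_group_ops, (field_add HK). Qed.

Lemma kadd_in x y : x ∈ kset -> y ∈ kset -> kadd x y ∈ kset.
Proof. apply (g_in _ _ _ k_group). Qed.

Lemma kmul_app2 x y z : x ∈ kset -> y ∈ kset -> app2 (fmul K) x y z <-> z = kmul x y.
Proof. apply (fun2_app2 _ _ _ _ _ _ _ (mul_fun HK)). Qed.

Lemma kadd_app2 x y z : x ∈ kset -> y ∈ kset -> app2 (fadd K) x y z <-> z = kadd x y.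
Proof. apply (fun2_app2 _ _ _ _ _ _ _ (add_fun (field_add HK))). Qed.

Lemma kmul_in x y : x ∈ kset -> y ∈ kset -> kmul x y ∈ kset.
Proof. apply (fun2_in _ _ _ _ _ _ (mul_fun HK)). Qed.

Hint Resolve kadd_in kmul_in : kdb.

Lemma kone_in : fone K ∈ kset.
Proof. apply (one_in HK). Qed.
Lemma kzero_in : fzero K ∈ kset.
Proof. apply (zero_in (field_add HK)). Qed.

Lemma kmulA x y z : x ∈ kset -> y ∈ kset -> z ∈ kset ->
  kmul (kmul x y) z = kmul x (kmul y z).
Proof.
  intros Hx Hy Hz.
  destruct (mul_assoc HK Hx Hy Hz) as [a [b [r [Ha [Hb [Hr Hs]]]]]].
  apply kmul_app2 in Ha, Hb; auto; subst.
  apply kmul_app2 in Hr, Hs; auto with kdb; congruence.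
Qed.

Lemma kmulC x y : x ∈ kset -> y ∈ kset -> kmul x y = kmul y x.
Proof.
  intros Hx Hy; destruct (mul_comm HK Hx Hy) as [r [Ha Hb]].
  apply kmul_app2 in Ha, Hb; auto; congruence.
Qed.

Lemma kmul1 x : x ∈ kset -> kmul (fone K) x = x.
Proof.
  intros Hx; pose proof (mul_one HK Hx) as H.
  apply kmul_app2 in H; auto using kone_in.
Qed.

Lemma kmulDr x y z : x ∈ kset -> y ∈ kset -> z ∈ kset ->
  kmul x (kadd y z) = kadd (kmul x y) (kmul x z).
Proof.
  intros Hx Hy Hz; destruct (mul_add HK Hx Hy Hz) as [a [b [c' [r [Ha [Hr [Hb [Hc Hs]]]]]]]].
  apply kadd_app2 in Ha; auto; apply kmul_app2 in Hb; auto; apply kmul_app2 in Hc; auto.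
  subst; apply kmul_app2 in Hr; auto with kdb; apply kadd_app2 in Hs; auto with kdb.
  congruence.
Qed.

Lemma kmulDl x y z : x ∈ kset -> y ∈ kset -> z ∈ kset ->
  kmul (kadd x y) z = kadd (kmul x z) (kmul y z).
Proof.
  intros; rewrite kmulC, kmulDr, (kmulC z x), (kmulC z y); auto with kdb.
Qed.

Lemma kinv_ex x : x ∈ kset -> x <> fzero K ->
  exists y, y ∈ kset /\ kmul y x = fone K.
Proof.
  intros Hx Hn; destruct (mul_inv HK Hx Hn) as [y [Hy H]]; exists y; split; [exact Hy|].
  rewrite kmulC; auto; apply kmul_app2 in H; auto.
Qed.

Lemma k_vspace_ops : vspace_ops kset kadd (fzero K) kmul.
Proof.
  constructor; auto using k_group, kmul1, kmulDr, kmulDl, kmulA with kdb.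
Qed.

(** A graph built by [lam2] is known to return the intended value only at arguments in the carriers;
    this comparison transfers laws from the defining term to the graph. *)
Lemma vspace_ops_ext (V : M) add add' zero sc sc' :
  (forall x y, x ∈ V -> y ∈ V -> add x y = add' x y) ->
  (forall a x, a ∈ kset -> x ∈ V -> sc a x = sc' a x) ->
  vspace_ops V add zero sc -> vspace_ops V add' zero sc'.
Proof.
  intros E F [H1 H2 H3 H4 H5 H6].
  pose proof (g_in _ _ _ H1) as G.
  constructor.
  - apply (group_ops_ext _ _ _ _ E H1).
  - intros; rewrite <- F; auto.
  - intros a b x Ha Hb Hx; rewrite <- (F b x), <- !F; auto with kdb.
  - intros; rewrite <- F; auto using kone_in.
  - intros a x y Ha Hx Hy; rewrite <- (E x y), <- !F, <- E; auto.
  - intros; rewrite <- !F, <- E; auto with kdb.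
Qed.

Lemma vspace_iff (E : vspace_data M) : is_vspace K E <->
  is_fun2 (vadd E) (vcarrier E) (vcarrier E) (vcarrier E) /\
  is_fun2 (vscal E) kset (vcarrier E) (vcarrier E) /\
  vspace_ops (vcarrier E) (op2 (vadd E)) (vzero E) (op2 (vscal E)).
Proof.
  split.
  - intros [H1 H2 H3 H4 H5 H6].
    apply abelian_group_ops in H1; destruct H1 as [Hf G].
    pose proof (fun x y z => fun2_app2 _ _ _ _ x y z Hf) as A.
    pose proof (fun x y z => fun2_app2 _ _ _ _ x y z H2) as B.
    pose proof (g_in _ _ _ G) as I.
    pose proof (fun x y => fun2_in _ _ _ _ x y H2) as J. fold kset in *.
    split; [exact Hf|split; [exact H2|]]; constructor; auto.
    + intros a b x Ha Hb Hx.
      destruct (H3 a b x Ha Hb Hx) as [ab [bx [r [E1 [E2 [E3 E4]]]]]].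
      apply kmul_app2 in E1; auto; apply B in E2; auto; subst.
      apply B in E3; auto with kdb; apply B in E4; auto; congruence.
    + intros x Hx; specialize (H4 x Hx); apply B in H4; auto using kone_in.
    + intros a x y Ha Hx Hy.
      destruct (H5 a x y Ha Hx Hy) as [s [ax [ay [r [E1 [E2 [E3 [E4 E5]]]]]]]].
      apply A in E1; auto; apply B in E3; auto; apply B in E4; auto; subst.
      apply B in E2; auto; apply A in E5; auto; congruence.
    + intros a b x Ha Hb Hx.
      destruct (H6 a b x Ha Hb Hx) as [s [ax [ay [r [E1 [E2 [E3 [E4 E5]]]]]]]].
      apply kadd_app2 in E1; auto; apply B in E3; auto; apply B in E4; auto; subst.
      apply B in E2; auto with kdb; apply A in E5; auto; congruence.
  - intros [Hf [H2 [G J H3 H4 H5 H6]]].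
    pose proof (fun x y z => fun2_app2 _ _ _ _ x y z Hf) as A.
    pose proof (fun x y z => fun2_app2 _ _ _ _ x y z H2) as B.
    pose proof (g_in _ _ _ G) as I.
    constructor; auto; fold kset.
    + apply abelian_group_ops; auto.
    + intros a b x Ha Hb Hx.
      exists (kmul a b), (op2 (vscal E) b x), (op2 (vscal E) a (op2 (vscal E) b x)).
      rewrite kmul_app2, !B; auto with kdb.
      repeat split; symmetry; auto.
    + intros x Hx; rewrite B; auto using kone_in; symmetry; auto.
    + intros a x y Ha Hx Hy.
      exists (op2 (vadd E) x y), (op2 (vscal E) a x), (op2 (vscal E) a y),
        (op2 (vscal E) a (op2 (vadd E) x y)).
      rewrite !A, !B; auto; repeat split; auto.
    + intros a b x Ha Hb Hx.
      exists (kadd a b), (op2 (vscal E) a x), (op2 (vscal E) b x),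
        (op2 (vscal E) (kadd a b) x).
      rewrite A, kadd_app2, !B; auto with kdb; repeat split; auto.
Qed.

Definition vspace_of_ops (V : M) (add : M -> M -> M) (zero : M) (sc : M -> M -> M) :
  vspace_data M := VspaceData V (lam2 V V add) zero (lam2 kset V sc).

Lemma vspace_of_ops_vspace (V : M) add zero sc :
  tdef (fun e => add (e 0) (e 1)) -> tdef (fun e => sc (e 0) (e 1)) ->
  vspace_ops V add zero sc -> is_vspace K (vspace_of_ops V add zero sc).
Proof.
  intros Ha Hs H; apply vspace_iff; simpl; split; [|split].
  - apply lam2_fun2; [exact Ha|apply (g_in _ _ _ (v_group _ _ _ _ H))].
  - apply lam2_fun2; [exact Hs|apply (v_in _ _ _ _ H)].
  - apply (vspace_ops_ext V add _ zero sc); [| |exact H];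
      intros; rewrite op2_lam2; auto.
Qed.

Lemma vspace_of_field_vspace : is_vspace K (vspace_of_field K).
Proof.
  apply vspace_iff; simpl; split; [|split].
  - apply (add_fun (field_add HK)).
  - apply (mul_fun HK).
  - apply k_vspace_ops.
Qed.

Definition linear_ops (E E' : vspace_data M) (f : M) : Prop :=
  is_fun f (vcarrier E) (vcarrier E') /\
  (forall x y, x ∈ vcarrier E -> y ∈ vcarrier E ->
     ap f (op2 (vadd E) x y) = op2 (vadd E') (ap f x) (ap f y)) /\
  (forall a x, a ∈ kset -> x ∈ vcarrier E ->
     ap f (op2 (vscal E) a x) = op2 (vscal E') a (ap f x)).

Lemma linear_iff (E E' : vspace_data M) (f : M) : is_vspace K E -> is_vspace K E' ->
  is_linear K E E' f <-> linear_ops E E' f.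
Proof.
  intros HE HE'; apply vspace_iff in HE, HE'.
  destruct HE as [Hf [Hs H]], HE' as [Hf' [Hs' H']].
  pose proof (fun x y z => fun2_app2 _ _ _ _ x y z Hf) as A.
  pose proof (fun x y z => fun2_app2 _ _ _ _ x y z Hs) as B.
  pose proof (fun x y z => fun2_app2 _ _ _ _ x y z Hf') as A'.
  pose proof (fun x y z => fun2_app2 _ _ _ _ x y z Hs') as B'.
  pose proof (g_in _ _ _ (v_group _ _ _ _ H)) as I.
  pose proof (v_in _ _ _ _ H) as J.
  split.
  - intros [F G1 G2].
    pose proof (fun x y => fun_app _ _ _ x y F) as C'.
    pose proof (fun x => fun_ap_in _ _ _ x F) as D'.
    split; [exact F|split].
    + intros x y Hx Hy; destruct (G1 x y Hx Hy) as [s [fx [fy [r [E1 [E2 [E3 [E4 E5]]]]]]]].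
      apply A in E1; auto; apply C' in E3; auto; apply C' in E4; auto; subst.
      apply C' in E2; auto; apply A' in E5; auto; congruence.
    + intros a x Ha Hx; destruct (G2 a x Ha Hx) as [s [fx [r [E1 [E2 [E3 E4]]]]]].
      apply B in E1; auto; apply C' in E3; auto; subst.
      apply C' in E2; auto; apply B' in E4; auto; congruence.
  - intros [F [G1 G2]].
    pose proof (fun x y => fun_app _ _ _ x y F) as C'.
    pose proof (fun x => fun_ap_in _ _ _ x F) as D'.
    constructor; [exact F| |].
    + intros x y Hx Hy.
      exists (op2 (vadd E) x y), (ap f x), (ap f y), (ap f (op2 (vadd E) x y)).
      rewrite A, A', !C'; auto; repeat split; auto.
    + intros a x Ha Hx; fold kset in Ha.
      exists (op2 (vscal E) a x), (ap f x), (ap f (op2 (vscal E) a x)).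
      rewrite B, B', !C'; auto; repeat split; auto.
Qed.

(** * Consequences of the vector space laws *)

Section Vectors.
Context (V : M) (add : M -> M -> M) (zero : M) (sc : M -> M -> M).
Context (H : vspace_ops V add zero sc).

Let G := v_group _ _ _ _ H.
Let add_in := g_in _ _ _ G.
Let zero_in := g_zero_in _ _ _ G.
Let addA := g_assoc _ _ _ G.
Let addC := g_comm _ _ _ G.
Let sc_in := v_in _ _ _ _ H.
Hint Resolve add_in zero_in sc_in kone_in kzero_in kadd_in kmul_in : kdb.

Lemma vadd_zero_r x : x ∈ V -> add x zero = x.
Proof. intros Hx; rewrite addC; auto; apply (g_zero _ _ _ G); exact Hx. Qed.

Lemma vadd_exchange x y z w : x ∈ V -> y ∈ V -> z ∈ V -> w ∈ V ->
  add (add x y) (add z w) = add (add x z) (add y w).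
Proof.
  intros; rewrite <- !addA, (addA y z w), (addC y z), <- (addA z y w); auto with kdb.
Qed.

Lemma vadd_cancel x y z : x ∈ V -> y ∈ V -> z ∈ V -> add x y = add x z -> y = z.
Proof.
  intros Hx Hy Hz E; destruct (g_opp _ _ _ G x Hx) as [x' [Hx' K']].
  rewrite <- (g_zero _ _ _ G y Hy), <- (g_zero _ _ _ G z Hz), <- K', (addC x x'),
    <- !addA, E; auto.
Qed.

Lemma vscal_zero_l x : x ∈ V -> sc (fzero K) x = zero.
Proof.
  intros Hx; apply (vadd_cancel (sc (fzero K) x)); auto with kdb.
  rewrite <- (v_add_l _ _ _ _ H), vadd_zero_r; auto with kdb.
  f_equal; apply (g_zero _ _ _ k_group); auto with kdb.
Qed.

Lemma vscal_zero_r a : a ∈ kset -> sc a zero = zero.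
Proof.
  intros Ha; apply (vadd_cancel (sc a zero)); auto with kdb.
  rewrite <- (v_add_r _ _ _ _ H), !vadd_zero_r; auto with kdb.
Qed.

Lemma vscal_eq_zero a x : a ∈ kset -> x ∈ V -> x <> zero -> sc a x = zero ->
  a = fzero K.
Proof.
  intros Ha Hx Nx E; apply NNPP; intros Na; apply Nx.
  destruct (kinv_ex a Ha Na) as [b [Hb I]].
  rewrite <- (v_one _ _ _ _ H x Hx), <- I, (v_assoc _ _ _ _ H), E; auto.
  apply vscal_zero_r; exact Hb.
Qed.

(** The signature has no opposites, so the opposite of a vector is written as its multiple by some
    [m] with 1 + [m] = 0. The same device supplies the differences in later arguments. *)
Lemma vopp m x : m ∈ kset -> kadd (fone K) m = fzero K -> x ∈ V ->
  add x (sc m x) = zero.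
Proof.
  intros Hm Em Hx.
  rewrite <- (v_one _ _ _ _ H x Hx) at 1.
  rewrite <- (v_add_l _ _ _ _ H), Em, vscal_zero_l; auto with kdb.
Qed.

Definition linear_subset (W : M) : Prop :=
  (forall x, x ∈ W -> x ∈ V) /\ zero ∈ W /\
  (forall x y, x ∈ W -> y ∈ W -> add x y ∈ W) /\
  (forall a x, a ∈ kset -> x ∈ W -> sc a x ∈ W).

Lemma linear_subset_ops W : linear_subset W -> vspace_ops W add zero sc.
Proof.
  intros [HV [H0 [Ha Hs]]]; pose proof H as [[G1 G2 G3 G4 G5 G6] V1 V2 V3 V4 V5].
  destruct (g_opp _ _ _ k_group _ kone_in) as [m [Hm Em]].
  constructor; auto; constructor; auto.
  intros x Hx; exists (sc m x); auto using vopp.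
Qed.
End Vectors.

Lemma minus_one_ex : exists m, m ∈ kset /\ kadd (fone K) m = fzero K.
Proof. apply (g_opp _ _ _ k_group _ kone_in). Qed.

(** The scalar a - b, written as a + m b with m = -1, kills the nonzero vector x and is therefore
    zero. *)
Lemma vscal_inj V add zero sc (H : vspace_ops V add zero sc) a b x :
  a ∈ kset -> b ∈ kset -> x ∈ V -> x <> zero -> sc a x = sc b x -> a = b.
Proof.
  intros Ha Hb Hx Nx E; destruct minus_one_ex as [m [Hm Em]].
  pose proof (vopp _ _ _ _ k_vspace_ops m) as O.
  pose proof (g_comm _ _ _ k_group) as C.
  apply (vadd_cancel _ _ _ _ k_vspace_ops (kmul m b)); auto with kdb.
  rewrite (C _ b), (O b), C; auto with kdb.
  apply (vscal_eq_zero _ _ _ _ H _ x); auto with kdb.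
  rewrite (v_add_l _ _ _ _ H), E, <- (v_add_l _ _ _ _ H), (O b); auto with kdb.
  apply (vscal_zero_l _ _ _ _ H); exact Hx.
Qed.

Lemma def_fun f A B : tdef f -> tdef A -> tdef B ->
  def (fun e => is_fun (f e) (A e) (B e)).
Proof.
  intros Hf HA HB.
  (* The formula is written for three variables; the terms [f], [A] and [B] are substituted one at a
     time afterwards. *)
  assert (D0 : def (fun e => (forall p, p ∈ e 0 -> exists x y, x ∈ e 1 /\ y ∈ e 2 /\
      p = opair x y) /\ (forall x, x ∈ e 1 -> exists y, opair x y ∈ e 0 /\
      forall z, opair x z ∈ e 0 -> y = z))) by dfn.
  apply def_iff with (P := fun e => (forall p, p ∈ f e -> exists x y, x ∈ A e /\
    y ∈ B e /\ p = opair x y) /\ (forall x, x ∈ A e -> exists y, opair x y ∈ f e /\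
      forall z, opair x z ∈ f e -> y = z)).
  - intros e; split; intros [H1 H2]; split.
    + intros p Hp; destruct (H1 p Hp) as [x [y [Hx [Hy E]]]]; exists x, y.
      rewrite pair_eq; auto.
    + intros x Hx; destruct (H2 x Hx) as [y [Hy U]]; exists y; split.
      * apply app_opair, Hy.
      * intros z Hz; apply U, app_opair, Hz.
    + intros p Hp; destruct (H1 p Hp) as [x [y [Hx [Hy E]]]]; exists x, y.
      rewrite pair_eq in E; auto.
    + intros x Hx; destruct (H2 x Hx) as [y [Hy U]]; exists y; split.
      * apply app_opair, Hy.
      * intros z Hz; apply U, app_opair, Hz.
  - apply (def_subst (fun u e => (forall p, p ∈ u -> exists x y, x ∈ A e /\
    y ∈ B e /\ p = opair x y) /\ (forall x, x ∈ A e -> exists y, opair x y ∈ u /\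
      forall z, opair x z ∈ u -> y = z)) f Hf).
    apply (def_subst (fun a e => (forall p, p ∈ e 0 -> exists x y, x ∈ a /\
      y ∈ B (fun i => e (S i)) /\ p = opair x y) /\ (forall x, x ∈ a ->
      exists y, opair x y ∈ e 0 /\ forall z, opair x z ∈ e 0 -> y = z))
      (fun e => A (fun i => e (S i))) (tdef_shift _ HA)).
    apply (def_subst (fun b e => (forall p, p ∈ e 1 -> exists x y, x ∈ e 0 /\
      y ∈ b /\ p = opair x y) /\ (forall x, x ∈ e 0 ->
      exists y, opair x y ∈ e 1 /\ forall z, opair x z ∈ e 1 -> y = z))
      (fun e => B (fun i => e (S (S i)))) (tdef_shift2 _ HB)).
    exact (def_ren (fun i => match i with O => 2 | 1 => 1 | _ => O end) _ D0).
Qed.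

Ltac dfn_atom ::= lazymatch goal with
  | |- def (fun e => is_fun (@?f e) (@?A e) (@?B e)) => apply (def_fun f A B); dfn
  | |- _ => progress unfold kadd, kmul; dfn
  end.

(** * From linear extenders to linear forms *)

Lemma LE_imp_D : LE K -> D K.
Proof.
  intros HLE E HE [x0 [Hx0 Nx0]].
  pose proof (proj1 (vspace_iff E) HE) as [Hf [Hs H]].
  set (V := vcarrier E) in *. set (add := op2 (vadd E)) in *.
  set (sc := op2 (vscal E)) in *. set (zero := vzero E) in *.
  pose proof (g_in _ _ _ (v_group _ _ _ _ H)) as add_in.
  pose proof (v_in _ _ _ _ H) as sc_in.
  set (L := sep V (fun y => exists a, a ∈ kset /\ y = sc a x0)).
  assert (HL : forall y, y ∈ L <-> exists a, a ∈ kset /\ y = sc a x0).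
  { intros y; unfold L; rewrite mem_sep; [|unfold sc; dfn].
    split; [tauto|]. intros [a [Ha ->]]; split; eauto. }
  assert (HLs : linear_subset V add zero sc L).
  { split; [|split; [|split]].
    - intros x Hx; apply HL in Hx; destruct Hx as [a [Ha ->]]; auto.
    - apply HL; exists (fzero K); split; [apply kzero_in|].
      symmetry; apply (vscal_zero_l _ _ _ _ H); exact Hx0.
    - intros x y Hx Hy; apply HL in Hx, Hy; destruct Hx as [a [Ha ->]], Hy as [b [Hb ->]].
      apply HL; exists (kadd a b); rewrite (v_add_l _ _ _ _ H); auto with kdb.
    - intros b x Hb Hx; apply HL in Hx; destruct Hx as [a [Ha ->]].
      apply HL; exists (kmul b a); rewrite (v_assoc _ _ _ _ H); auto with kdb. }
  pose proof (linear_subset_ops _ _ _ _ H _ HLs) as HLo.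
  set (F := vspace_of_ops L add zero sc).
  assert (HF : is_vspace K F) by (apply vspace_of_ops_vspace; unfold add, sc; [dfn|dfn|exact HLo]).
  assert (Ea : forall x y, x ∈ L -> y ∈ L -> op2 (vadd F) x y = add x y).
  { intros; simpl; apply op2_lam2; auto; unfold add; dfn. }
  assert (Es : forall a y, a ∈ kset -> y ∈ L -> op2 (vscal F) a y = sc a y).
  { intros; simpl; apply op2_lam2; auto; unfold sc; dfn. }
  assert (HFE : is_subspace K F E).
  { pose proof (proj1 (vspace_iff F) HF) as [HfF [HsF _]].
    constructor; [exact HF|exact (proj1 HLs)| |].
    - intros x y z Hx Hy Hz; apply (fun2_app2 _ _ _ _ _ _ _ HfF) in Hz; auto.
      rewrite Ea in Hz; auto. apply (fun2_app2 _ _ _ _ _ _ _ Hf); auto; apply HLs; auto.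
    - intros a x z Ha Hx Hz; apply (fun2_app2 _ _ _ _ _ _ _ HsF) in Hz; auto.
      rewrite Es in Hz; auto. apply (fun2_app2 _ _ _ _ _ _ _ Hs); auto; apply HLs; auto. }
  (* The coordinate along [x0] can be given by unique description: as [x0] is nonzero, a vector of
     the line has a single coefficient. *)
  set (f := lam L (fun y => iota (fun a => a ∈ kset /\ y = sc a x0))).
  assert (Ef : forall a, a ∈ kset -> ap f (sc a x0) = a).
  { intros a Ha; unfold f; rewrite ap_lam; [|unfold sc; dfn|apply HL; eauto].
    apply iota_eq; [auto|]. intros b [Hb Eb]; symmetry.
    apply (vscal_inj _ _ _ _ H _ _ x0); auto. }
  assert (Lf : is_linear_form K F f).
  { apply linear_iff; [exact HF|exact vspace_of_field_vspace|].
    split; [|split]; simpl.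
    - apply lam_fun; [unfold sc; dfn|]. intros y Hy; apply HL in Hy.
      destruct Hy as [a [Ha Ey]]. rewrite (iota_eq _ a); auto.
      intros b [Hb Eb]; apply (vscal_inj _ _ _ _ H _ _ x0); auto; congruence.
    - intros x y Hx Hy; rewrite (Ea x y Hx Hy : op2 (lam2 L L add) x y = add x y).
      apply HL in Hx, Hy; destruct Hx as [a [Ha ->]], Hy as [b [Hb ->]].
      rewrite <- (v_add_l _ _ _ _ H), !Ef; auto with kdb.
    - intros b x Hb Hx; rewrite (Es b x Hb Hx : op2 (lam2 kset L sc) b x = sc b x).
      apply HL in Hx; destruct Hx as [a [Ha ->]].
      rewrite <- (v_assoc _ _ _ _ H), !Ef; auto with kdb. }
  destruct (HLE E F HE HFE) as [Fs [Es' [HFs [HEs [T [HT Hext]]]]]].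
  assert (Hfs : f ∈ vcarrier Fs) by (apply (dual_carrier HFs), Lf).
  destruct (Hext f Hfs) as [g [Hg Hgf]].
  assert (Hge : g ∈ vcarrier Es').
  { pose proof (linear_fun HT) as HTf; apply (fun_app _ _ _ _ _ HTf Hfs) in Hg.
    subst g; apply (fun_ap_in _ _ _ _ HTf Hfs). }
  apply (dual_carrier HEs) in Hge.
  (* The nonzero value is taken at [x0], whose coordinate is 1. *)
  exists g; split; [exact Hge|]. exists x0, (fone K); split; [exact Hx0|split].
  - apply Hgf. rewrite <- (v_one _ _ _ _ H x0 Hx0).
    assert (H1 : sc (fone K) x0 ∈ L) by (apply HL; eauto using kone_in).
    apply (fun_app _ _ _ _ _ (linear_fun Lf) H1).
    symmetry; apply Ef, kone_in.
  - apply (one_neq_zero HK).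
Qed.

Ltac kin_atom := fail.
Ltac kin := cbv beta; lazymatch goal with
  | |- kadd _ _ ∈ kset => apply kadd_in; kin
  | |- kmul _ _ ∈ kset => apply kmul_in; kin
  | |- fone K ∈ kset => apply kone_in
  | |- fzero K ∈ kset => apply kzero_in
  | |- _ ∈ _ => first [assumption | kin_atom]
  | |- ?a = ?a => reflexivity
  | |- _ => assumption
  end.

Definition funset (A B : M) : M := sep (power (prod A B)) (fun f => is_fun f A B).

Lemma mem_funset f A B : f ∈ funset A B <-> is_fun f A B.
Proof.
  unfold funset; rewrite mem_sep by dfn; split; [tauto|].
  intros H; split; [apply fun_sub, H|exact H].
Qed.

Lemma lam_ext (A : M) (s t : M -> M) :
  tdef (fun e => s (e 0)) -> tdef (fun e => t (e 0)) ->
  (forall x, x ∈ A -> s x = t x) -> lam A s = lam A t.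
Proof.
  intros Hs Ht E; apply (fun_ext _ _ A (image A s) (image A t)).
  - apply lam_fun; [exact Hs|]; intros; apply mem_image; eauto.
  - apply lam_fun; [exact Ht|]; intros; apply mem_image; eauto.
  - intros x Hx; rewrite !ap_lam; auto.
Qed.

(** * The dual space *)

Section Dual.
Context (E : vspace_data M) (HE : is_vspace K E).

(** [LE] asks for the duals as sets of the model, so the forms are separated from a power set and
    the pointwise operations become graphs. *)
Definition dual : vspace_data M :=
  vspace_of_ops
    (sep (power (prod (vcarrier E) kset)) (linear_ops E (vspace_of_field K)))
    (fun f g => lam (vcarrier E) (fun x => kadd (ap f x) (ap g x)))
    (lam (vcarrier E) (fun _ => fzero K))
    (fun a f => lam (vcarrier E) (fun x => kmul a (ap f x))).

Lemma form_iff f : is_linear_form K E f <->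
  is_fun f (vcarrier E) kset /\
  (forall x y, x ∈ vcarrier E -> y ∈ vcarrier E ->
     ap f (op2 (vadd E) x y) = kadd (ap f x) (ap f y)) /\
  (forall a x, a ∈ kset -> x ∈ vcarrier E ->
     ap f (op2 (vscal E) a x) = kmul a (ap f x)).
Proof. apply linear_iff; [exact HE|apply vspace_of_field_vspace]. Qed.

Lemma mem_dual f : f ∈ vcarrier dual <-> is_linear_form K E f.
Proof.
  simpl; rewrite mem_sep; [|unfold linear_ops; simpl; dfn].
  rewrite form_iff; unfold linear_ops; simpl.
  split; [tauto|]. intros H; split; [apply fun_sub, H|exact H].
Qed.

Lemma mem_dual_ops f : f ∈ vcarrier dual <->
  is_fun f (vcarrier E) kset /\
  (forall x y, x ∈ vcarrier E -> y ∈ vcarrier E ->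
     ap f (op2 (vadd E) x y) = kadd (ap f x) (ap f y)) /\
  (forall a x, a ∈ kset -> x ∈ vcarrier E ->
     ap f (op2 (vscal E) a x) = kmul a (ap f x)).
Proof. rewrite mem_dual; apply form_iff. Qed.

Lemma form_in f x : f ∈ vcarrier dual -> x ∈ vcarrier E -> ap f x ∈ kset.
Proof. intros Hf; apply mem_dual_ops in Hf; apply fun_ap_in, Hf. Qed.

Lemma form_ext f g : f ∈ vcarrier dual -> g ∈ vcarrier dual ->
  (forall x, x ∈ vcarrier E -> ap f x = ap g x) -> f = g.
Proof.
  intros Hf Hg; apply mem_dual_ops in Hf, Hg. exact (fun_ext _ _ _ _ _ (proj1 Hf) (proj1 Hg)).
Qed.

Lemma lam_form (t : M -> M) : tdef (fun e => t (e 0)) ->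
  (forall x, x ∈ vcarrier E -> t x ∈ kset) ->
  (forall x y, x ∈ vcarrier E -> y ∈ vcarrier E ->
     t (op2 (vadd E) x y) = kadd (t x) (t y)) ->
  (forall a x, a ∈ kset -> x ∈ vcarrier E -> t (op2 (vscal E) a x) = kmul a (t x)) ->
  lam (vcarrier E) t ∈ vcarrier dual.
Proof.
  intros Ht Hk Ha Hs; apply mem_dual_ops.
  apply vspace_iff in HE; destruct HE as [_ [_ H]].
  pose proof (g_in _ _ _ (v_group _ _ _ _ H)); pose proof (v_in _ _ _ _ H).
  split; [apply lam_fun; assumption|].
  split; intros; rewrite !ap_lam; auto.
Qed.

Lemma kadd_exchange x y z w : x ∈ kset -> y ∈ kset -> z ∈ kset -> w ∈ kset ->
  kadd (kadd x y) (kadd z w) = kadd (kadd x z) (kadd y w).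
Proof. apply (vadd_exchange _ _ _ _ k_vspace_ops). Qed.

Lemma kmulCA x y z : x ∈ kset -> y ∈ kset -> z ∈ kset ->
  kmul x (kmul y z) = kmul y (kmul x z).
Proof. intros; rewrite <- !kmulA, (kmulC x y); auto. Qed.

Ltac kin_atom ::= apply form_in; assumption.

(** By extensionality of forms each law is checked pointwise, where it is a law of K viewed as a
    vector space over itself. The linearity of the forms serves for closure under the operations. *)
Lemma dual_ops : vspace_ops (vcarrier dual)
  (fun f g => lam (vcarrier E) (fun x => kadd (ap f x) (ap g x)))
  (lam (vcarrier E) (fun _ => fzero K))
  (fun a f => lam (vcarrier E) (fun x => kmul a (ap f x))).
Proof.
  pose proof k_vspace_ops as [[_ k2 k3 _ k5 _] _ k7 k8 k9 k10].
  destruct minus_one_ex as [m [Hm Em]].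
  assert (I1 : forall f g, f ∈ vcarrier dual -> g ∈ vcarrier dual ->
    lam (vcarrier E) (fun x => kadd (ap f x) (ap g x)) ∈ vcarrier dual).
  { intros f g Hf Hg; pose proof (proj1 (mem_dual_ops f) Hf) as [_ [f1 f2]].
    pose proof (proj1 (mem_dual_ops g) Hg) as [_ [g1 g2]].
    apply lam_form; [dfn| | |]; intros.
    - kin.
    - rewrite f1, g1, kadd_exchange; kin.
    - rewrite f2, g2, kmulDr; kin. }
  assert (I2 : lam (vcarrier E) (fun _ => fzero K) ∈ vcarrier dual).
  { apply lam_form; [dfn| | |]; intros.
    - kin.
    - rewrite k5; kin.
    - rewrite (vscal_zero_r _ _ _ _ k_vspace_ops); auto. }
  assert (I3 : forall a f, a ∈ kset -> f ∈ vcarrier dual ->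
    lam (vcarrier E) (fun x => kmul a (ap f x)) ∈ vcarrier dual).
  { intros a f Ha Hf; pose proof (proj1 (mem_dual_ops f) Hf) as [_ [f1 f2]].
    apply lam_form; [dfn| | |]; intros.
    - kin.
    - rewrite f1, kmulDr; kin.
    - rewrite f2, kmulCA; kin. }
  Ltac din I1 I2 I3 := repeat first [assumption | exact I2 | apply kadd_in | apply kmul_in
    | apply kone_in | apply I1 | apply I3].
  constructor; [constructor|..]; try assumption.
  - intros f g h Hf Hg Hh; apply form_ext; [din I1 I2 I3..|intros x Hx].
    rewrite !ap_lam by (assumption || dfn). apply k2; kin.
  - intros f g Hf Hg; apply form_ext; [din I1 I2 I3..|intros x Hx].
    rewrite !ap_lam by (assumption || dfn). apply k3; kin.
  - intros f Hf; apply form_ext; [din I1 I2 I3..|intros x Hx].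
    rewrite !ap_lam by (assumption || dfn). apply k5; kin.
  - intros f Hf; exists (lam (vcarrier E) (fun x => kmul m (ap f x))); split; [din I1 I2 I3|].
    apply form_ext; [din I1 I2 I3..|intros x Hx].
    rewrite !ap_lam by (assumption || dfn).
    apply (vopp _ _ _ _ k_vspace_ops); kin.
  - intros a b f Ha Hb Hf; apply form_ext; [din I1 I2 I3..|intros x Hx].
    rewrite !ap_lam by (assumption || dfn). apply k7; kin.
  - intros f Hf; apply form_ext; [din I1 I2 I3..|intros x Hx].
    rewrite !ap_lam by (assumption || dfn). apply k8; kin.
  - intros a f g Ha Hf Hg; apply form_ext; [din I1 I2 I3..|intros x Hx].
    rewrite !ap_lam by (assumption || dfn). apply k9; kin.
  - intros a b f Ha Hb Hf; apply form_ext; [din I1 I2 I3..|intros x Hx].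
    rewrite !ap_lam by (assumption || dfn). apply k10; kin.
Qed.

Lemma dual_is_vspace : is_vspace K dual.
Proof.
  pose proof dual_ops as H; unfold dual in *; simpl in H.
  apply vspace_of_ops_vspace; [dfn|dfn|exact H].
Qed.

Lemma dual_vadd f g : f ∈ vcarrier dual -> g ∈ vcarrier dual ->
  op2 (vadd dual) f g = lam (vcarrier E) (fun x => kadd (ap f x) (ap g x)).
Proof. intros Hf Hg; apply op2_lam2; [dfn|exact Hf|exact Hg]. Qed.

Lemma dual_vscal a f : a ∈ kset -> f ∈ vcarrier dual ->
  op2 (vscal dual) a f = lam (vcarrier E) (fun x => kmul a (ap f x)).
Proof. intros Ha Hf; apply op2_lam2; [dfn|exact Ha|exact Hf]. Qed.

Lemma dual_is_dual : is_dual K E dual.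
Proof.
  pose proof dual_is_vspace as HD.
  pose proof (proj1 (vspace_iff dual) HD) as [HA [HS H]].
  assert (Ap : forall f x y, f ∈ vcarrier dual -> x ∈ vcarrier E ->
    app f x y <-> y = ap f x).
  { intros f x y Hf Hx; apply mem_dual_ops in Hf; exact (fun_app _ _ _ _ _ (proj1 Hf) Hx). }
  constructor; [exact HD|exact mem_dual| |].
  - intros f g h x Hf Hg Hh Hx; apply (fun2_app2 _ _ _ _ _ _ _ HA) in Hh; auto.
    exists (ap f x), (ap g x), (kadd (ap f x) (ap g x)).
    rewrite !Ap, kadd_app2; try kin.
    + repeat split; auto. rewrite Hh, dual_vadd, ap_lam; auto; dfn.
    + subst h; apply (g_in _ _ _ (v_group _ _ _ _ H)); auto.
  - intros a f h x Ha Hf Hh Hx; apply (fun2_app2 _ _ _ _ _ _ _ HS) in Hh; auto.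
    exists (ap f x), (kmul a (ap f x)).
    fold kset in Ha. rewrite !Ap, kmul_app2; try kin.
    + repeat split; auto. rewrite Hh, dual_vscal, ap_lam; auto; dfn.
    + subst h; apply (v_in _ _ _ _ H); auto.
Qed.
End Dual.

(** * The quotient of K^X by eventual equality *)

Section ReducedPower.
Context (X : M).

Definition eventually (Q : M -> Prop) : Prop :=
  forall p, p ∈ X -> exists q, q ∈ X /\ (forall x, x ∈ p -> x ∈ q) /\
  forall r, r ∈ X -> (forall x, x ∈ q -> x ∈ r) -> Q r.

Lemma eventually_all (Q : M -> Prop) : (forall r, r ∈ X -> Q r) -> eventually Q.
Proof. intros H p Hp; exists p; auto. Qed.

(** The witness for [R] is sought above the witness [q] for [Q]; beyond it both hold, because [Q]
    persists upwards from [q]. *)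
Lemma eventually_and (Q R S : M -> Prop) : eventually Q -> eventually R ->
  (forall r, r ∈ X -> Q r -> R r -> S r) -> eventually S.
Proof.
  intros HQ HR H p Hp; destruct (HQ p Hp) as [q [Hq [Hpq K1]]].
  destruct (HR q Hq) as [s [Hs [Hqs K2]]]; exists s.
  split; [exact Hs|split; [auto|]]; intros r Hr Hsr; apply H; auto.
Qed.

Lemma eventually_mono (Q S : M -> Prop) : eventually Q ->
  (forall r, r ∈ X -> Q r -> S r) -> eventually S.
Proof. intros HQ H; apply (eventually_and Q Q); auto. Qed.

Definition cls (f : M) : M :=
  sep (funset X kset) (fun g => eventually (fun r => ap f r = ap g r)).

Lemma mem_cls f g : g ∈ cls f <->
  is_fun g X kset /\ eventually (fun r => ap f r = ap g r).
Proof. unfold cls; rewrite mem_sep, mem_funset; [tauto|unfold eventually; dfn]. Qed.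

Lemma cls_eq f g : is_fun f X kset -> is_fun g X kset ->
  cls f = cls g <-> eventually (fun r => ap f r = ap g r).
Proof.
  intros Hf Hg; split.
  - intros E; assert (H : g ∈ cls g) by (apply mem_cls; auto using eventually_all).
    rewrite <- E in H; apply mem_cls in H; apply H.
  - intros E; apply (zf_extensionality HM); intros h; rewrite !mem_cls.
    split; intros [Hh L]; (split; [exact Hh|]);
      apply (eventually_and _ _ _ E L); congruence.
Qed.

Definition germ (t : M -> M) : M := cls (lam X t).

(** These are maps that have a graph on X in the model. Every element of the quotient is the germ of
    one, so computations there can be done with terms. *)
Definition kvalued (t : M -> M) : Prop :=
  tdef (fun e => t (e 0)) /\ forall r, r ∈ X -> t r ∈ kset.

Lemma germ_eq (s t : M -> M) : kvalued s -> kvalued t ->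
  germ s = germ t <-> eventually (fun r => s r = t r).
Proof.
  intros [Ds Hs] [Dt Ht]; unfold germ; rewrite cls_eq; auto using lam_fun.
  split; intros H; apply (eventually_mono _ _ H); intros r Hr; rewrite !ap_lam; auto.
Qed.

Lemma germ_eta f : is_fun f X kset -> germ (ap f) = cls f.
Proof.
  intros Hf; unfold germ; f_equal; apply (fun_ext _ _ X kset kset); auto.
  - apply lam_fun; [dfn|]. intros x Hx; apply (fun_ap_in _ _ _ _ Hf Hx).
  - intros x Hx; apply ap_lam; [dfn|exact Hx].
Qed.

Definition germs : M := image (funset X kset) cls.

Lemma mem_germs u : u ∈ germs <-> exists t, kvalued t /\ u = germ t.
Proof.
  unfold germs; rewrite mem_image by (unfold cls, eventually; dfn); split.
  - intros [f [Hf ->]]; apply mem_funset in Hf; exists (ap f).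
    rewrite germ_eta; auto; split; [split|]; auto; [dfn|].
    intros r Hr; apply (fun_ap_in _ _ _ _ Hf Hr).
  - intros [t [[Dt Ht] ->]]; exists (lam X t); split; [|reflexivity].
    apply mem_funset, lam_fun; assumption.
Qed.

Lemma germ_in (t : M -> M) : kvalued t -> germ t ∈ germs.
Proof. intros; apply mem_germs; eauto. Qed.

(** Instead of choosing representatives, the sum is described as the one class that every pair of
    representatives produces. *)
Definition germs_add (u v : M) : M :=
  iota (fun w => exists f g, is_fun f X kset /\ is_fun g X kset /\
    u = cls f /\ v = cls g /\ w = germ (fun r => kadd (ap f r) (ap g r))).

Definition germs_scal (a u : M) : M :=
  iota (fun w => exists f, is_fun f X kset /\ u = cls f /\
    w = germ (fun r => kmul a (ap f r))).

Lemma kvalued_add (s t : M -> M) : kvalued s -> kvalued t -> kvalued (fun r => kadd (s r) (t r)).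
Proof. intros [Ds Hs] [Dt Ht]; split; [dfn|auto using kadd_in]. Qed.

Lemma kvalued_scal a (t : M -> M) : a ∈ kset -> kvalued t -> kvalued (fun r => kmul a (t r)).
Proof. intros Ha [Dt Ht]; split; [dfn|auto using kmul_in]. Qed.

Lemma kvalued_mul (s t : M -> M) : kvalued s -> kvalued t -> kvalued (fun r => kmul (s r) (t r)).
Proof. intros [Ds Hs] [Dt Ht]; split; [dfn|auto using kmul_in]. Qed.

Lemma kvalued_const a : a ∈ kset -> kvalued (fun _ => a).
Proof. split; [dfn|auto]. Qed.

Lemma kvalued_ap f : is_fun f X kset -> kvalued (ap f).
Proof. intros Hf; split; [dfn|]. intros r; apply (fun_ap_in _ _ _ _ Hf). Qed.

(** Independence of the representatives is the uniqueness half of the description: the two eventual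
    equalities hold together eventually, and there the sums agree. *)
Lemma germs_add_germ (s t : M -> M) : kvalued s -> kvalued t ->
  germs_add (germ s) (germ t) = germ (fun r => kadd (s r) (t r)).
Proof.
  intros Hs Ht; apply iota_eq.
  - exists (lam X s), (lam X t); pose proof Hs as [Ds Ks]; pose proof Ht as [Dt Kt].
    split; [apply lam_fun; assumption|split; [apply lam_fun; assumption|]].
    do 2 (split; [reflexivity|]).
    unfold germ; apply (f_equal cls), lam_ext; [dfn|dfn|].
    intros x Hx; rewrite !ap_lam; auto.
  - intros w [f [g [Hf [Hg [E1 [E2 ->]]]]]].
    rewrite <- (germ_eta f Hf) in E1; rewrite <- (germ_eta g Hg) in E2.
    apply germ_eq in E1; [|assumption|apply kvalued_ap; assumption].
    apply germ_eq in E2; [|assumption|apply kvalued_ap; assumption].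
    apply germ_eq; [auto using kvalued_add, kvalued_ap..|].
    apply (eventually_and _ _ _ E1 E2); congruence.
Qed.

Lemma germs_scal_germ a (t : M -> M) : a ∈ kset -> kvalued t ->
  germs_scal a (germ t) = germ (fun r => kmul a (t r)).
Proof.
  intros Ha Ht; apply iota_eq.
  - exists (lam X t); pose proof Ht as [Dt Kt].
    split; [apply lam_fun; assumption|split; [reflexivity|]].
    unfold germ; apply (f_equal cls), lam_ext; [dfn|dfn|].
    intros x Hx; rewrite !ap_lam; auto.
  - intros w [f [Hf [E1 ->]]].
    rewrite <- (germ_eta f Hf) in E1.
    apply germ_eq in E1; [|assumption|apply kvalued_ap; assumption].
    apply germ_eq; [auto using kvalued_scal, kvalued_ap..|].
    apply (eventually_mono _ _ E1); congruence.
Qed.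

Definition reduced_power : vspace_data M :=
  vspace_of_ops germs germs_add (germ (fun _ => fzero K)) germs_scal.

Lemma germ_congr (s t : M -> M) : kvalued s -> kvalued t -> (forall r, r ∈ X -> s r = t r) ->
  germ s = germ t.
Proof. intros Hs Ht H; apply germ_eq; auto using eventually_all. Qed.

(** The laws hold at every index because they hold in K, and an identity at every index is an
    eventual one. *)
Lemma germs_ops : vspace_ops germs germs_add (germ (fun _ => fzero K)) germs_scal.
Proof.
  pose proof k_vspace_ops as [[_ k2 k3 _ k5 _] _ k7 k8 k9 k10].
  destruct minus_one_ex as [m [Hm Em]].
  pose proof (vopp _ _ _ _ k_vspace_ops m) as k6.
  pose proof (kvalued_const _ kzero_in) as Z.
  constructor; [constructor|..].
  - intros x y Hx Hy; apply mem_germs in Hx, Hy.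
    destruct Hx as [s [Hs ->]], Hy as [t [Ht ->]].
    rewrite germs_add_germ; auto using germ_in, kvalued_add.
  - intros x y z Hx Hy Hz; apply mem_germs in Hx, Hy, Hz.
    destruct Hx as [s [Hs ->]], Hy as [t [Ht ->]], Hz as [u [Hu ->]].
    rewrite !germs_add_germ by auto using kvalued_add.
    apply germ_congr; auto using kvalued_add.
    intros r Hr; apply k2; [apply Hs|apply Ht|apply Hu]; exact Hr.
  - intros x y Hx Hy; apply mem_germs in Hx, Hy.
    destruct Hx as [s [Hs ->]], Hy as [t [Ht ->]].
    rewrite !germs_add_germ by assumption.
    apply germ_congr; auto using kvalued_add.
    intros r Hr; apply k3; [apply Hs|apply Ht]; exact Hr.
  - apply germ_in, Z.
  - intros x Hx; apply mem_germs in Hx; destruct Hx as [s [Hs ->]].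
    rewrite germs_add_germ by assumption.
    apply germ_congr; auto using kvalued_add.
    intros r Hr; apply k5, Hs, Hr.
  - intros x Hx; apply mem_germs in Hx; destruct Hx as [s [Hs ->]].
    exists (germ (fun r => kmul m (s r))); split; [auto using germ_in, kvalued_scal|].
    rewrite germs_add_germ by auto using kvalued_scal.
    apply germ_congr; auto using kvalued_add, kvalued_scal.
    intros r Hr; apply k6; auto; apply Hs, Hr.
  - intros a x Ha Hx; apply mem_germs in Hx; destruct Hx as [s [Hs ->]].
    rewrite germs_scal_germ; auto using germ_in, kvalued_scal.
  - intros a b x Ha Hb Hx; apply mem_germs in Hx; destruct Hx as [s [Hs ->]].
    rewrite !germs_scal_germ by auto using kvalued_scal, kmul_in.
    apply germ_congr; auto using kvalued_scal, kmul_in.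
    intros r Hr; apply k7; auto; apply Hs, Hr.
  - intros x Hx; apply mem_germs in Hx; destruct Hx as [s [Hs ->]].
    rewrite germs_scal_germ by auto using kone_in.
    apply germ_congr; auto using kvalued_scal, kone_in.
    intros r Hr; apply k8; auto; apply Hs, Hr.
  - intros a x y Ha Hx Hy; apply mem_germs in Hx, Hy.
    destruct Hx as [s [Hs ->]], Hy as [t [Ht ->]].
    rewrite !germs_add_germ, !germs_scal_germ, !germs_add_germ
      by auto using kvalued_scal, kvalued_add.
    apply germ_congr; auto using kvalued_scal, kvalued_add.
    intros r Hr; apply k9; auto; [apply Hs|apply Ht]; exact Hr.
  - intros a b x Ha Hb Hx; apply mem_germs in Hx; destruct Hx as [s [Hs ->]].
    rewrite !germs_scal_germ, !germs_add_germ by auto using kvalued_scal, kadd_in.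
    apply germ_congr; auto using kvalued_scal, kvalued_add, kadd_in.
    intros r Hr; apply k10; auto; apply Hs, Hr.
Qed.

Lemma reduced_power_vspace : is_vspace K reduced_power.
Proof.
  apply vspace_of_ops_vspace; [| |exact germs_ops];
    unfold germs_add, germs_scal, germ, cls, eventually; dfn.
Qed.

(** * Linear forms on the quotient *)

Section Functional.
Context (phi : M) (Hphi : is_linear_form K reduced_power phi).

Lemma germ_form_in (t : M -> M) : kvalued t -> ap phi (germ t) ∈ kset.
Proof.
  intros Ht; apply (fun_ap_in _ germs _ _ (linear_fun Hphi)), germ_in, Ht.
Qed.

Lemma germ_form_add (s t : M -> M) : kvalued s -> kvalued t ->
  ap phi (germ (fun r => kadd (s r) (t r))) = kadd (ap phi (germ s)) (ap phi (germ t)).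
Proof.
  intros Hs Ht; pose proof (proj1 (form_iff _ reduced_power_vspace phi) Hphi) as [_ [H _]].
  rewrite <- H by (apply germ_in; assumption).
  rewrite <- germs_add_germ by assumption; symmetry; f_equal.
  apply op2_lam2; try apply germ_in; auto.
  unfold germs_add, germ, cls, eventually; dfn.
Qed.

Lemma germ_form_scal a (t : M -> M) : a ∈ kset -> kvalued t ->
  ap phi (germ (fun r => kmul a (t r))) = kmul a (ap phi (germ t)).
Proof.
  intros Ha Ht; pose proof (proj1 (form_iff _ reduced_power_vspace phi) Hphi) as [_ [_ H]].
  rewrite <- H by (assumption || apply germ_in; assumption).
  rewrite <- germs_scal_germ by assumption; symmetry; f_equal.
  apply op2_lam2; try apply germ_in; auto.
  unfold germs_scal, germ, cls, eventually; dfn.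
Qed.

(** A form on the quotient cannot distinguish maps that agree eventually; identities that may fail
    for some W thus become exact once [phi] is applied. *)
Lemma germ_form_eq (s t : M -> M) : kvalued s -> kvalued t -> eventually (fun r => s r = t r) ->
  ap phi (germ s) = ap phi (germ t).
Proof. intros Hs Ht E; f_equal; apply germ_eq; assumption. Qed.
End Functional.

(** If the constants 1 and 0 agreed eventually, they would agree at some index above [p], which is
    impossible in a field. *)
Lemma reduced_power_non_null : (exists p, p ∈ X) -> non_null_vspace reduced_power.
Proof.
  intros [p Hp]; exists (germ (fun _ => fone K)); split.
  - apply germ_in, kvalued_const, kone_in.
  - simpl; intros E; apply germ_eq in E; auto using kvalued_const, kone_in, kzero_in.
    destruct (E p Hp) as [q [Hq [_ H]]]; apply (one_neq_zero HK), (H q); auto.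
Qed.
End ReducedPower.

(** * From linear forms to linear extenders *)

Section Extender.
Context (E F : vspace_data M) (HE : is_vspace K E) (HF : is_subspace K F E).

Let V := vcarrier E.
Let U := vcarrier F.
Let add := op2 (vadd E).
Let sc := op2 (vscal E).
Let zero := vzero E.

Lemma E_ops : vspace_ops V add zero sc.
Proof. apply vspace_iff, HE. Qed.

Let add_in := g_in _ _ _ (v_group _ _ _ _ E_ops).
Let sc_in := v_in _ _ _ _ E_ops.
Let add_zero := g_zero _ _ _ (v_group _ _ _ _ E_ops).
Let zero_in := g_zero_in _ _ _ (v_group _ _ _ _ E_ops).
Let addC := g_comm _ _ _ (v_group _ _ _ _ E_ops).
Let exchange := vadd_exchange _ _ _ _ E_ops.

Lemma subspace_op_add x y : x ∈ U -> y ∈ U -> op2 (vadd F) x y = add x y.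
Proof.
  intros Hx Hy; pose proof (proj1 (vspace_iff F) (subspace_vspace HF)) as [HfF _].
  pose proof (proj1 (vspace_iff E) HE) as [Hf _].
  apply (fun2_app2 _ _ _ _ _ _ _ Hf); try apply (subspace_incl HF); auto.
  apply (subspace_add HF); auto. apply (fun2_app2 _ _ _ _ _ _ _ HfF); auto.
Qed.

Lemma subspace_op_scal a x : a ∈ kset -> x ∈ U -> op2 (vscal F) a x = sc a x.
Proof.
  intros Ha Hx; pose proof (proj1 (vspace_iff F) (subspace_vspace HF)) as [_ [HsF _]].
  pose proof (proj1 (vspace_iff E) HE) as [_ [Hs _]].
  apply (fun2_app2 _ _ _ _ _ _ _ Hs); try apply (subspace_incl HF); auto.
  apply (subspace_scal HF); auto. apply (fun2_app2 _ _ _ _ _ _ _ HsF); auto.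
Qed.

Lemma subspace_linear_subset : linear_subset V add zero sc U.
Proof.
  pose proof (proj1 (vspace_iff F) (subspace_vspace HF)) as [_ [_ [G S _ _ _ _]]].
  assert (I : forall x, x ∈ U -> x ∈ V) by exact (subspace_incl HF).
  assert (S' : forall a x, a ∈ kset -> x ∈ U -> sc a x ∈ U).
  { intros a x Ha Hx; rewrite <- subspace_op_scal by assumption; apply S; assumption. }
  split; [exact I|split; [|split; [|exact S']]].
  - pose proof (g_zero_in _ _ _ G) as Z.
    (* [F] comes with its own zero; the zero of [E] is 0 times that vector, hence lies in [F]. *)
    rewrite <- (vscal_zero_l _ _ _ _ E_ops _ (I _ Z)); apply S'; [apply kzero_in|exact Z].
  - intros x y Hx Hy; rewrite <- subspace_op_add by assumption.
    apply (g_in _ _ _ G); assumption.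
Qed.

Let U_sub := proj1 subspace_linear_subset.
Let U_zero := proj1 (proj2 subspace_linear_subset).
Let U_add := proj1 (proj2 (proj2 subspace_linear_subset)).
Let U_sc := proj2 (proj2 (proj2 subspace_linear_subset)).

(** * Subspaces avoiding F and the projections along them *)

Definition disjoints : M := sep (power V) (fun W =>
  linear_subset V add zero sc W /\ forall x, x ∈ W -> x ∈ U -> x = zero).

Lemma mem_disjoints W : W ∈ disjoints <->
  linear_subset V add zero sc W /\ forall x, x ∈ W -> x ∈ U -> x = zero.
Proof.
  unfold disjoints; rewrite mem_sep by (unfold linear_subset, add, sc; dfn).
  split; [tauto|]; intros H; split; [apply mem_power, H|exact H].
Qed.

(** [x] is the projection of [d] onto F along [W], as a relation because [d] may lie outside F +
    W. *)
Definition splits (W d x : M) : Prop := x ∈ U /\ exists w, w ∈ W /\ d = add x w.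

(** The difference x - y of two projections lies in F and equals the difference v - w of the
    components in W; as W avoids F, it is zero. *)
Lemma splits_unique W d x y : W ∈ disjoints -> splits W d x -> splits W d y -> x = y.
Proof.
  intros HW [Hx [w [Hw ->]]] [Hy [v [Hv Ev]]]; apply mem_disjoints in HW.
  destruct HW as [[WV [W0 [WA WS]]] WU]; destruct minus_one_ex as [m [Hm Em]].
  pose proof (fun z => vopp _ _ _ _ E_ops m z Hm Em) as O.
  assert (D0 : add x (sc m y) = add v (sc m w)).
  (* The vector -y - w is added to both decompositions; regrouping leaves x - y on one side and v -
     w on the other. *)
  { assert (E1 : add (add x w) (add (sc m y) (sc m w)) = add x (sc m y)).
    { rewrite exchange, O, (vadd_zero_r _ _ _ _ E_ops); [reflexivity|auto..]. }
    rewrite <- E1, Ev, exchange, O, add_zero; [reflexivity|auto..]. }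
  assert (Z : add x (sc m y) = zero) by (apply WU; [rewrite D0|]; auto).
  apply (vadd_cancel _ _ _ _ E_ops (sc m y)); auto.
  rewrite (addC _ x), Z, (addC _ y), O; [reflexivity|auto..].
Qed.

Lemma splits_add W d d' x x' : W ∈ disjoints -> splits W d x -> splits W d' x' ->
  splits W (add d d') (add x x').
Proof.
  intros HW [Hx [w [Hw ->]]] [Hx' [w' [Hw' ->]]]; apply mem_disjoints in HW.
  destruct HW as [[WV [W0 [WA WS]]] _].
  split; [auto|exists (add w w'); split; [auto|apply exchange; auto]].
Qed.

Lemma splits_scal W a d x : W ∈ disjoints -> a ∈ kset -> splits W d x ->
  splits W (sc a d) (sc a x).
Proof.
  intros HW Ha [Hx [w [Hw ->]]]; apply mem_disjoints in HW.
  destruct HW as [[WV [W0 [WA WS]]] _].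
  split; [auto|exists (sc a w); split; [auto|apply (v_add_r _ _ _ _ E_ops); auto]].
Qed.

Lemma splits_id W x : W ∈ disjoints -> x ∈ U -> splits W x x.
Proof.
  intros HW Hx; apply mem_disjoints in HW; split; [exact Hx|exists zero].
  split; [apply HW|rewrite (vadd_zero_r _ _ _ _ E_ops); [reflexivity|auto]].
Qed.

Lemma splits_mono W W' d x : (forall w, w ∈ W -> w ∈ W') -> splits W d x -> splits W' d x.
Proof. intros HW [Hx [w [Hw Ee]]]; split; eauto. Qed.

Lemma disjoints_inhabited : exists W, W ∈ disjoints.
Proof.
  exists (upair zero zero); apply mem_disjoints; split; [split; [|split; [|split]]|].
  - intros x Hx; apply mem_upair in Hx; destruct Hx; subst; auto.
  - apply mem_upair; auto.
  - intros x y Hx Hy; apply mem_upair in Hx, Hy; apply mem_upair; left.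
    destruct Hx, Hy; subst; rewrite add_zero; [reflexivity|auto..].
  - intros a x Ha Hx; apply mem_upair in Hx; apply mem_upair; left.
    destruct Hx; subst; apply (vscal_zero_r _ _ _ _ E_ops); auto.
  - intros x Hx _; apply mem_upair in Hx; destruct Hx; auto.
Qed.

(** The multiples of [d] are added to [W]. If w + a d lies in F with a nonzero, then d lies in F +
    W, against the hypothesis; so a = 0, and w lies in both W and F, hence is zero. *)
Lemma adjoin_line W d : W ∈ disjoints -> d ∈ V -> ~ (exists x, splits W d x) ->
  exists W', W' ∈ disjoints /\ (forall w, w ∈ W -> w ∈ W') /\ d ∈ W'.
Proof.
  intros HW He Ne; apply mem_disjoints in HW; destruct HW as [[WV [W0 [WA WS]]] WU].
  set (W' := sep V (fun y => exists w a, w ∈ W /\ a ∈ kset /\ y = add w (sc a d))).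
  assert (HW' : forall y, y ∈ W' <-> exists w a, w ∈ W /\ a ∈ kset /\ y = add w (sc a d)).
  { intros y; unfold W'; rewrite mem_sep by (unfold add, sc; dfn).
    split; [tauto|]; intros H; split; [|exact H].
    destruct H as [w [a [Hw [Ha ->]]]]; auto. }
  assert (WW' : forall w, w ∈ W -> w ∈ W').
  { intros w Hw; apply HW'; exists w, (fzero K); split; [exact Hw|split; [apply kzero_in|]].
    rewrite (vscal_zero_l _ _ _ _ E_ops), (vadd_zero_r _ _ _ _ E_ops); [reflexivity|auto..]. }
  exists W'; split; [|split; [exact WW'|]].
  - apply mem_disjoints; split; [split; [|split; [|split]]|].
    + intros y Hy; apply HW' in Hy; destruct Hy as [w [a [Hw [Ha ->]]]]; auto.
    + auto.
    + intros y z Hy Hz; apply HW' in Hy, Hz; apply HW'.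
      destruct Hy as [w [a [Hw [Ha ->]]]], Hz as [v [b [Hv [Hb ->]]]].
      exists (add w v), (kadd a b); split; [auto|split; [apply kadd_in; auto|]].
      rewrite exchange, (v_add_l _ _ _ _ E_ops); [reflexivity|auto..].
    + intros b y Hb Hy; apply HW' in Hy; apply HW'.
      destruct Hy as [w [a [Hw [Ha ->]]]].
      exists (sc b w), (kmul b a); split; [auto|split; [apply kmul_in; auto|]].
      rewrite (v_add_r _ _ _ _ E_ops), (v_assoc _ _ _ _ E_ops); [reflexivity|auto..].
    + intros y Hy HyU; apply HW' in Hy; destruct Hy as [w [a [Hw [Ha Ey]]]].
      destruct (classic (a = fzero K)) as [Ea|Na].
      * subst a; rewrite (vscal_zero_l _ _ _ _ E_ops), (vadd_zero_r _ _ _ _ E_ops) in Ey;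
          auto. subst y; auto.
      * exfalso; apply Ne; destruct (kinv_ex a Ha Na) as [b [Hb I]].
        destruct minus_one_ex as [m [Hm Em]].
        (* Solving y = w + a d gives d = b y - b w with b the inverse of a; [m] = -1 supplies the
           sign. *)
        exists (sc b y); split; [auto|exists (sc m (sc b w)); split; [auto|]].
        rewrite Ey, (v_add_r _ _ _ _ E_ops), <- (v_assoc _ _ _ _ E_ops b a), I,
          (v_one _ _ _ _ E_ops), (addC (sc b w) d), <- (g_assoc _ _ _ (v_group _ _ _ _ E_ops)),
          (vopp _ _ _ _ E_ops m), (vadd_zero_r _ _ _ _ E_ops); [reflexivity|auto..].
  - apply HW'; exists zero, (fone K); split; [auto|split; [apply kone_in|]].
    rewrite (v_one _ _ _ _ E_ops), add_zero; [reflexivity|auto..].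
Qed.

Lemma eventually_splits d : d ∈ V -> eventually disjoints (fun W => exists x, splits W d x).
Proof.
  intros He W HW; destruct (classic (exists x, splits W d x)) as [[x Hx]|Ne].
  - exists W; split; [exact HW|split; [auto|]]; intros W' _ I; exists x.
    apply (splits_mono W); auto.
  (* When [d] does not split along [W], it is adjoined to [W]; as d = 0 + d, it then splits with
     projection 0 along every larger subspace. *)
  - destruct (adjoin_line W d HW He Ne) as [W' [HW' [I He']]]; exists W'.
    split; [exact HW'|split; [exact I|]]; intros R _ J; exists zero.
    apply (splits_mono W'); [exact J|]; split; [exact U_zero|exists d; split; [exact He'|]].
    rewrite add_zero; [reflexivity|exact He].
Qed.

(* The value at [d] of [f] composed with the projection onto [F] along [W];
   0 when [d] is outside [F + W]. *)
Definition value (f d W : M) : M := iota (fun z =>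
  (exists x, splits W d x /\ z = ap f x) \/ (~ (exists x, splits W d x) /\ z = fzero K)).

Lemma value_splits f d W x : W ∈ disjoints -> splits W d x -> value f d W = ap f x.
Proof.
  intros HW Hx; apply iota_eq; [left; eauto|].
  intros z [[y [Hy ->]]|[N _]]; [|exfalso; eauto].
  rewrite (splits_unique W d x y); auto.
Qed.

Lemma kvalued_value f d : is_fun f U kset -> kvalued disjoints (value f d).
Proof.
  intros Hf; split; [unfold value, splits, add; dfn|]; intros W HW.
  destruct (classic (exists x, splits W d x)) as [[x Hx]|N].
  - rewrite (value_splits f d W x HW Hx); apply (fun_ap_in _ _ _ _ Hf), Hx.
  - unfold value; rewrite (iota_eq _ (fzero K)); [apply kzero_in|right; auto|].
    intros z [[y [Hy _]]|[_ Ez]]; [exfalso; eauto|exact Ez].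
Qed.

(** * The extender attached to a normalised form *)

Context (phi : M) (Hphi : is_linear_form K (reduced_power disjoints) phi).
Context (u : M -> M) (Hu : kvalued disjoints u).
Context (Hphiu : ap phi (germ disjoints u) = fone K).

(** [phi] may vanish at the class of the constant 1; the factor [u] makes the class of a u, for a
    scalar a, go to a. *)
Definition extension (f d : M) : M :=
  ap phi (germ disjoints (fun W => kmul (u W) (value f d W))).

Let X := disjoints.

Lemma kvalued_uv f d : is_fun f U kset ->
  kvalued X (fun W => kmul (u W) (value f d W)).
Proof. intros Hf; apply kvalued_mul; [exact Hu|apply kvalued_value, Hf]. Qed.

Lemma extension_in f d : is_fun f U kset -> extension f d ∈ kset.
Proof. intros Hf; apply germ_form_in; [exact Hphi|apply kvalued_uv, Hf]. Qed.

Lemma mem_dual_F f : f ∈ vcarrier (dual F) -> is_fun f U kset /\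
  (forall x y, x ∈ U -> y ∈ U -> ap f (add x y) = kadd (ap f x) (ap f y)) /\
  (forall a x, a ∈ kset -> x ∈ U -> ap f (sc a x) = kmul a (ap f x)).
Proof.
  intros Hf; apply (mem_dual_ops _ (subspace_vspace HF)) in Hf.
  destruct Hf as [H1 [H2 H3]]; split; [exact H1|split].
  - intros x y Hx Hy; rewrite <- subspace_op_add by assumption; auto.
  - intros a x Ha Hx; rewrite <- subspace_op_scal by assumption; auto.
Qed.

(** One statement serves twice: with f = g = h for additivity in the vector, and with d = d' = d''
    for additivity in the form. *)
Lemma extension_add_gen f g h d d' d'' :
  is_fun f U kset -> is_fun g U kset -> is_fun h U kset ->
  eventually X (fun W => value h d'' W = kadd (value f d W) (value g d' W)) ->
  extension h d'' = kadd (extension f d) (extension g d').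
Proof.
  intros Hf Hg Hh H; unfold extension.
  rewrite <- (germ_form_add _ phi Hphi) by (apply kvalued_uv; assumption).
  apply germ_form_eq; [apply kvalued_uv, Hh|apply kvalued_add; apply kvalued_uv; assumption|].
  apply (eventually_mono _ _ _ H); intros W HW EW; rewrite EW.
  apply kmulDr; [apply Hu, HW|apply kvalued_value|apply kvalued_value]; assumption.
Qed.

Lemma extension_scal_gen a f h d d'' : a ∈ kset ->
  is_fun f U kset -> is_fun h U kset ->
  eventually X (fun W => value h d'' W = kmul a (value f d W)) ->
  extension h d'' = kmul a (extension f d).
Proof.
  intros Ha Hf Hh H; unfold extension.
  rewrite <- (germ_form_scal _ phi Hphi) by (assumption || apply kvalued_uv; assumption).
  apply germ_form_eq; [apply kvalued_uv, Hh|apply kvalued_scal; [|apply kvalued_uv]; assumption|].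
  apply (eventually_mono _ _ _ H); intros W HW EW; rewrite EW.
  apply kmulCA; [apply Hu, HW|exact Ha|apply kvalued_value; assumption].
Qed.

(** Along a W for which both vectors split, the projection of the sum is the sum of the projections,
    and f is additive on F. *)
Lemma extension_add f d d' : f ∈ vcarrier (dual F) -> d ∈ V -> d' ∈ V ->
  extension f (add d d') = kadd (extension f d) (extension f d').
Proof.
  intros Hf He He'; destruct (mem_dual_F f Hf) as [H1 [H2 _]].
  apply extension_add_gen; auto.
  apply (eventually_and _ _ _ _ (eventually_splits d He) (eventually_splits d' He')).
  intros W HW [x Hx] [x' Hx'].
  rewrite (value_splits _ _ _ _ HW (splits_add _ _ _ _ _ HW Hx Hx')),
    (value_splits _ _ _ _ HW Hx), (value_splits _ _ _ _ HW Hx').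
  apply H2; [apply Hx|apply Hx'].
Qed.

Lemma extension_scal f a d : f ∈ vcarrier (dual F) -> a ∈ kset -> d ∈ V ->
  extension f (sc a d) = kmul a (extension f d).
Proof.
  intros Hf Ha He; destruct (mem_dual_F f Hf) as [H1 [_ H3]].
  apply extension_scal_gen; auto.
  apply (eventually_mono _ _ _ (eventually_splits d He)).
  intros W HW [x Hx].
  rewrite (value_splits _ _ _ _ HW (splits_scal _ _ _ _ HW Ha Hx)),
    (value_splits _ _ _ _ HW Hx).
  apply H3; [exact Ha|apply Hx].
Qed.

Lemma extension_on_F f x : f ∈ vcarrier (dual F) -> x ∈ U -> extension f x = ap f x.
Proof.
  intros Hf Hx; destruct (mem_dual_F f Hf) as [H1 _].
  assert (Hk : ap f x ∈ kset) by apply (fun_ap_in _ _ _ _ H1 Hx).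
  (* Along every W the projection of x is x, so the map under [phi] is u times the scalar f(x),
     which homogeneity takes out. *)
  transitivity (kmul (ap f x) (ap phi (germ disjoints u))).
  - rewrite <- (germ_form_scal _ phi Hphi) by assumption.
    apply germ_form_eq; [apply kvalued_uv, H1|apply kvalued_scal; assumption|].
    apply eventually_all; intros W HW.
    rewrite (value_splits f x W x HW (splits_id W x HW Hx)).
    apply kmulC; [apply Hu, HW|exact Hk].
  - rewrite Hphiu, kmulC, kmul1; auto using kone_in.
Qed.

(** Joint definability in f and d makes the extender a set: one abstraction forms each T(f), a
    second one forms T. Here [phi] enters as a parameter and [u] through its own definability. *)
Lemma tdef_extension : tdef (fun e => extension (e 0) (e 1)).
Proof.
  destruct Hu as [Du _].
  unfold extension, germ, cls, eventually, value, splits, add; dfn.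
Qed.

Lemma ap_lam_extension f d : d ∈ V -> ap (lam V (extension f)) d = extension f d.
Proof. intros Hd; pose proof tdef_extension; apply ap_lam; [dfn|exact Hd]. Qed.

Definition extender : M := lam (vcarrier (dual F)) (fun f => lam V (extension f)).

Lemma extension_form f : f ∈ vcarrier (dual F) ->
  lam V (extension f) ∈ vcarrier (dual E).
Proof.
  intros Hf; pose proof tdef_extension; apply (lam_form _ HE).
  - dfn.
  - intros x Hx; apply extension_in, mem_dual_F, Hf.
  - intros x y Hx Hy; apply extension_add; assumption.
  - intros a x Ha Hx; apply extension_scal; assumption.
Qed.

Lemma ap_extender f : f ∈ vcarrier (dual F) -> ap extender f = lam V (extension f).
Proof. intros Hf; pose proof tdef_extension; apply ap_lam; [dfn|exact Hf]. Qed.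

Lemma extender_linear : is_linear K (dual F) (dual E) extender.
Proof.
  pose proof tdef_extension as D0.
  pose proof (dual_is_vspace _ (subspace_vspace HF)) as HFs.
  pose proof (dual_is_vspace _ HE) as HEs.
  pose proof (proj1 (vspace_iff _) HFs) as [_ [_ OF]].
  apply linear_iff; [assumption|assumption|]; split; [|split].
  - apply lam_fun; [dfn|exact extension_form].
  - intros f g Hf Hg.
    assert (Hh := g_in _ _ _ (v_group _ _ _ _ OF) f g Hf Hg).
    rewrite (dual_vadd E) by (rewrite ap_extender by assumption; apply extension_form; assumption).
    rewrite !ap_extender by assumption.
    apply lam_ext.
    { dfn. }
    { dfn. }
    intros d He.
    rewrite !ap_lam_extension by assumption.
    apply extension_add_gen; try (apply mem_dual_F; assumption).
    (* Along a W for which d splits, all three forms are evaluated at the same projection, where the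
       sum of forms is pointwise. *)
    apply (eventually_mono _ _ _ (eventually_splits d He)); intros W HW [x Hx].
    rewrite (value_splits f d W x HW Hx), (value_splits g d W x HW Hx),
      (value_splits _ d W x HW Hx), (dual_vadd F f g Hf Hg).
    rewrite ap_lam; [reflexivity|dfn|apply Hx].
  - intros a f Ha Hf.
    assert (Hh := v_in _ _ _ _ OF a f Ha Hf).
    rewrite (dual_vscal E)
      by (assumption || rewrite ap_extender by assumption; apply extension_form; assumption).
    rewrite !ap_extender by assumption.
    apply lam_ext.
    { dfn. }
    { dfn. }
    intros d He.
    rewrite !ap_lam_extension by assumption.
    apply extension_scal_gen; try (assumption || apply mem_dual_F; assumption).
    apply (eventually_mono _ _ _ (eventually_splits d He)); intros W HW [x Hx].
    rewrite (value_splits f d W x HW Hx), (value_splits _ d W x HW Hx),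
      (dual_vscal F a f Ha Hf).
    rewrite ap_lam; [reflexivity|dfn|apply Hx].
Qed.

Lemma extender_extends f : f ∈ vcarrier (dual F) ->
  exists g, app extender f g /\ extends g f.
Proof.
  intros Hf; exists (lam V (extension f)); split.
  - apply (fun_app _ _ _ _ _ (linear_fun extender_linear) Hf).
    rewrite ap_extender; auto.
  - intros x y Hxy; destruct (mem_dual_F f Hf) as [H1 _].
    (* [extends] quantifies over the whole model, so membership of x in F is read off from the graph
       of f. *)
    assert (Hx : x ∈ U).
    { apply app_opair, (proj1 H1) in Hxy; destruct Hxy as [x' [y' [Hx' [_ Ep]]]].
      rewrite pair_eq in Ep; apply opair_inj in Ep; destruct Ep as [-> _]; exact Hx'. }
    apply (fun_app _ _ _ _ _ H1 Hx) in Hxy; subst y.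
    pose proof (proj1 (mem_dual_ops _ HE _) (extension_form f Hf)) as [H2 _].
    apply (fun_app _ _ _ _ _ H2 (U_sub _ Hx)).
    rewrite ap_lam_extension by apply U_sub, Hx.
    symmetry; apply extension_on_F; assumption.
Qed.
End Extender.

Lemma D_imp_LE : D K -> LE K.
Proof.
  intros HD E F HE HF; set (X := disjoints E F).
  (* The hypothesis is applied to one space only, and the resulting form serves all f. *)
  destruct (HD _ (reduced_power_vspace X)
              (reduced_power_non_null X (disjoints_inhabited E F HE)))
    as [phi [Hphi [w [z [Hw [Hz Nz]]]]]].
  exists (dual F), (dual E).
  split; [apply dual_is_dual, (subspace_vspace HF)|split; [apply dual_is_dual, HE|]].
  apply (fun_app _ _ _ _ _ (linear_fun Hphi) Hw) in Hz.
  apply mem_germs in Hw; destruct Hw as [t [Ht ->]].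
  assert (Hzk : z ∈ kset) by (subst z; apply germ_form_in; assumption).
  (* [phi] is only known to take some nonzero value z, at the germ of t; scaling t by the inverse of
     z yields the u with value 1. *)
  destruct (kinv_ex z Hzk Nz) as [c [Hc Ec]].
  assert (Hu : kvalued X (fun W => kmul c (t W))) by (apply kvalued_scal; assumption).
  assert (H1 : ap phi (germ X (fun W => kmul c (t W))) = fone K)
    by (rewrite (germ_form_scal X phi Hphi), <- Hz; assumption).
  exists (extender E F phi (fun W => kmul c (t W))); split.
  - apply extender_linear; assumption.
  - intros f Hf; apply extender_extends; assumption.
Qed.
End Algebra.
End Model.

Theorem theorem1 (M : set_structure) (HM : ZF M) (K : field_data M)
  (HK : is_field K) : D K <-> LE K.
Proof.
  split; [apply (D_imp_LE HM K HK)|apply (LE_imp_D HM K HK)].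
Qed.
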